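(* For every $\varphi\in\mathcal L$: if $\varphi$ is valid (over all bi-relational frames, equivalently over all flows with the real-valued semantics), then $\varphi\in\mathsf{GTL}$. Together with soundness, $\mathsf{GTL}=\mathsf G_{\mathrm{rel}}=\mathsf G_\mathbb R$.
   Context: $\mathcal L$: $\varphi,\psi ::= p \mid \varphi\wedge\psi \mid \varphi\vee\psi \mid \varphi\Rightarrow\psi \mid \varphi\Leftarrow\psi \mid \mathsf X\varphi \mid \mathsf Y\varphi \mid \mathsf G\varphi \mid \mathsf H\varphi \mid \varphi\,\mathsf U\,\psi \mid \varphi\,\mathsf S\,\psi$; $\top:=p_0\Rightarrow p_0$, $\bot:=p_0\Leftarrow p_0$, $\neg\varphi:=\varphi\Rightarrow\bot$, $\varphi\Leftrightarrow\psi:=(\varphi\Rightarrow\psi)\wedge(\psi\Rightarrow\varphi)$. $\mathsf{GTL}$ is the least set of $\mathcal L$-formulas containing: (I) all substitution instances of intuitionistic propositional tautologies; (II) $\varphi\Rightarrow(\psi\vee(\varphi\Leftarrow\psi))$; (III) $(\varphi\Rightarrow\psi)\vee(\psi\Rightarrow\varphi)$ and $\neg((\varphi\Leftarrow\psi)\wedge(\psi\Leftarrow\varphi))$; (IV) $\neg\mathsf X\bot$; $\mathsf X(\varphi\vee\psi)\Rightarrow(\mathsf X\varphi\vee\mathsf X\psi)$; $(\mathsf X\varphi\wedge\mathsf X\psi)\Rightarrow\mathsf X(\varphi\wedge\psi)$; $\mathsf X(\varphi\Rightarrow\psi)\Leftrightarrow(\mathsf X\varphi\Rightarrow\mathsf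 X\psi)$; $\mathsf G(\varphi\Rightarrow\psi)\Rightarrow(\mathsf G\varphi\Rightarrow\mathsf G\psi)$; $\mathsf G(\varphi\Rightarrow\psi)\Rightarrow(\theta\,\mathsf U\,\varphi\Rightarrow\theta\,\mathsf U\,\psi)$; $\mathsf G(\varphi\Rightarrow\psi)\Rightarrow(\varphi\,\mathsf U\,\theta\Rightarrow\psi\,\mathsf U\,\theta)$; $\mathsf G\varphi\Rightarrow\varphi\wedge\mathsf X\mathsf G\varphi$; $\psi\vee(\varphi\wedge\mathsf X(\varphi\,\mathsf U\,\psi))\Rightarrow\varphi\,\mathsf U\,\psi$; $\mathsf G(\varphi\Rightarrow\mathsf X\varphi)\Rightarrow(\varphi\Rightarrow\mathsf G\varphi)$; $\mathsf G(\psi\wedge\mathsf X\varphi\Rightarrow\varphi)\Rightarrow(\psi\,\mathsf U\,\varphi\Rightarrow\varphi)$; and the same eleven with $\mathsf X,\mathsf G,\mathsf U$ replaced by $\mathsf Y,\mathsf H,\mathsf S$; (V) $\varphi\Leftrightarrow\mathsf X\mathsf Y\varphi$, $\varphi\Leftrightarrow\mathsf Y\mathsf X\varphi$; closed under: from $\varphi\Rightarrow\psi$ infer $(\varphi\Leftarrow\theta)\Rightarrow(\psi\Leftarrow\theta)$; from $\varphi\Rightarrow\psi\vee\gamma$ infer $(\varphi\Leftarrow\psi)\Rightarrow\gamma$; modus ponens; necessitation for $\mathsf X,\mathsf Y,\mathsf G,\mathsf H$. Real-valued semantics: a flow $(T,S)$, $S$ a bijection; $V\colon\mathcal L\times T\to[0,1]$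 with $\min,\max$ for $\wedge,\vee$; $V(\varphi\Rightarrow\psi,t)=1$ if $V(\varphi,t)\le V(\psi,t)$ else $V(\psi,t)$; $V(\varphi\Leftarrow\psi,t)=0$ if $V(\varphi,t)\le V(\psi,t)$ else $V(\varphi,t)$; $V(\mathsf X\varphi,t)=V(\varphi,St)$; $V(\mathsf Y\varphi,t)=V(\varphi,S^{-1}t)$; $V(\mathsf G\varphi,t)=\inf_{n\ge0}V(\varphi,S^nt)$; $V(\mathsf H\varphi,t)=\inf_{n\ge0}V(\varphi,S^{-n}t)$; $V(\varphi\,\mathsf U\,\psi,t)=\sup_{n\ge0}\min\{V(\varphi,S^0t),\dots,V(\varphi,S^{n-1}t),V(\psi,S^nt)\}$; $\mathsf S$ dually with $S^{-i}$. $\mathsf G_\mathbb R$: formulas with $V=1$ everywhere for all flows and valuations. Bi-relational semantics: $(W,T,\le,S)$ with $(W,\le)$ linear; $[\![\cdot]\!]\colon\mathcal L\to2^{W\times T}$ with $[\![p]\!]$ downward closed in the first coordinate; $\cap,\cup$ for $\wedge,\vee$; $(w,t)\in[\![\varphi\Rightarrow\psi]\!]$ iff $\forall v\le w\,((v,t)\in[\![\varphi]\!]\to(v,t)\in[\![\psi]\!])$; $(w,t)\in[\![\varphi\Leftarrow\psi]\!]$ iff $\exists v\ge w\,((v,t)\in[\![\varphi]\!]\setminus[\![\psi]\!])$; $\mathsf X$: $(w,St)$; $\mathsf Y$: $(w,S^{-1}t)$; $\mathsf G$: all $(w,S^nt)$, $n\ge0$; $\mathsf H$: all $(w,S^{-n}t)$;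 $\mathsf U$: some $n\ge0$ with $\psi$ at $(w,S^nt)$ and $\varphi$ at $(w,S^it)$ for $i<n$; $\mathsf S$ dually. $\mathsf G_{\mathrm{rel}}$: formulas with $[\![\varphi]\!]=W\times T$ for all frames and valuations. *)

(* Defs.v *)
From Stdlib Require Import Reals.
Open Scope R_scope.

Inductive form : Type :=
| Var   : nat -> form
| And   : form -> form -> form
| Or    : form -> form -> form
| Imp   : form -> form -> form
| Coimp : form -> form -> form
| Nx    : form -> form
| Pv    : form -> form
| Gf    : form -> form
| Hp    : form -> form
| Until : form -> form -> form
| Since : form -> form -> form.

Definition ftop : form := Imp (Var 0) (Var 0).
Definition fbot : form := Coimp (Var 0) (Var 0).
Definition fneg (a : form) : form := Imp a fbot.
Definition fiff (a b : form) : form := And (Imp a b) (Imp b a).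

Inductive pform : Type :=
| PVar : nat -> pform
| PBot : pform
| PAnd : pform -> pform -> pform
| POr  : pform -> pform -> pform
| PImp : pform -> pform -> pform.

Fixpoint kforce (W : Type) (le : W -> W -> Prop) (v : nat -> W -> Prop)
  (A : pform) (w : W) : Prop :=
  match A with
  | PVar n => v n w
  | PBot => False
  | PAnd A B => kforce W le v A w /\ kforce W le v B w
  | POr A B => kforce W le v A w \/ kforce W le v B w
  | PImp A B => forall u, le w u -> kforce W le v A u -> kforce W le v B u
  end.

Definition ipc_tautology (A : pform) : Prop :=
  forall (W : Type) (le : W -> W -> Prop) (v : nat -> W -> Prop),
    (forall w, le w w) ->
    (forall x y z, le x y -> le y z -> le x z) ->
    (forall n x y, le x y -> v n x -> v n y) ->
    forall w, kforce W le v A w.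

Fixpoint psubst (s : nat -> form) (A : pform) : form :=
  match A with
  | PVar n => s n
  | PBot => fbot
  | PAnd A B => And (psubst s A) (psubst s B)
  | POr A B => Or (psubst s A) (psubst s B)
  | PImp A B => Imp (psubst s A) (psubst s B)
  end.

Inductive tense_axiom (N A : form -> form) (U : form -> form -> form) : form -> Prop :=
| ta_nbot : tense_axiom N A U (fneg (N fbot))
| ta_nor : forall a b, tense_axiom N A U (Imp (N (Or a b)) (Or (N a) (N b)))
| ta_nand : forall a b, tense_axiom N A U (Imp (And (N a) (N b)) (N (And a b)))
| ta_nimp : forall a b, tense_axiom N A U (fiff (N (Imp a b)) (Imp (N a) (N b)))
| ta_k : forall a b, tense_axiom N A U (Imp (A (Imp a b)) (Imp (A a) (A b)))
| ta_ur : forall a b c, tense_axiom N A U (Imp (A (Imp a b)) (Imp (U c a) (U c b)))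
| ta_ul : forall a b c, tense_axiom N A U (Imp (A (Imp a b)) (Imp (U a c) (U b c)))
| ta_fix : forall a, tense_axiom N A U (Imp (A a) (And a (N (A a))))
| ta_ufix : forall a b, tense_axiom N A U (Imp (Or b (And a (N (U a b)))) (U a b))
| ta_ind : forall a, tense_axiom N A U (Imp (A (Imp a (N a))) (Imp a (A a)))
| ta_uind : forall a b, tense_axiom N A U
    (Imp (A (Imp (And b (N a)) a)) (Imp (U b a) a)).

Inductive GTL : form -> Prop :=
| gtl_ipc : forall A s, ipc_tautology A -> GTL (psubst s A)
| gtl_coimp : forall a b, GTL (Imp a (Or b (Coimp a b)))
| gtl_lin : forall a b, GTL (Or (Imp a b) (Imp b a))
| gtl_colin : forall a b, GTL (fneg (And (Coimp a b) (Coimp b a)))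
| gtl_future : forall a, tense_axiom Nx Gf Until a -> GTL a
| gtl_past : forall a, tense_axiom Pv Hp Since a -> GTL a
| gtl_xy : forall a, GTL (fiff a (Nx (Pv a)))
| gtl_yx : forall a, GTL (fiff a (Pv (Nx a)))
| gtl_r1 : forall a b c, GTL (Imp a b) -> GTL (Imp (Coimp a c) (Coimp b c))
| gtl_r2 : forall a b c, GTL (Imp a (Or b c)) -> GTL (Imp (Coimp a b) c)
| gtl_mp : forall a b, GTL (Imp a b) -> GTL a -> GTL b
| gtl_necX : forall a, GTL a -> GTL (Nx a)
| gtl_necY : forall a, GTL a -> GTL (Pv a)
| gtl_necG : forall a, GTL a -> GTL (Gf a)
| gtl_necH : forall a, GTL a -> GTL (Hp a).

Definition itr {T : Type} (f : T -> T) (n : nat) (t : T) : T := Nat.iter n f t.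

Fixpoint rden (W T : Type) (le : W -> W -> Prop) (S Si : T -> T)
  (val : nat -> W -> T -> Prop) (a : form) (w : W) (t : T) : Prop :=
  match a with
  | Var n => val n w t
  | And a b => rden W T le S Si val a w t /\ rden W T le S Si val b w t
  | Or a b => rden W T le S Si val a w t \/ rden W T le S Si val b w t
  | Imp a b => forall v, le v w -> rden W T le S Si val a v t -> rden W T le S Si val b v t
  | Coimp a b => exists v, le w v /\ rden W T le S Si val a v t /\ ~ rden W T le S Si val b v t
  | Nx a => rden W T le S Si val a w (S t)
  | Pv a => rden W T le S Si val a w (Si t)
  | Gf a => forall n, rden W T le S Si val a w (itr S n t)
  | Hp a => forall n, rden W T le S Si val a w (itr Si n t)
  | Until a b => exists n, rden W T le S Si val b w (itr S n t) /\
        forall i, (i < n)%nat -> rden W T le S Si val a w (itr S i t)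
  | Since a b => exists n, rden W T le S Si val b w (itr Si n t) /\
        forall i, (i < n)%nat -> rden W T le S Si val a w (itr Si i t)
  end.

Definition Grel (a : form) : Prop :=
  forall (W T : Type) (le : W -> W -> Prop) (S Si : T -> T)
         (val : nat -> W -> T -> Prop),
    (forall w, le w w) ->
    (forall x y z, le x y -> le y z -> le x z) ->
    (forall x y, le x y -> le y x -> x = y) ->
    (forall x y, le x y \/ le y x) ->
    (forall t, S (Si t) = t) -> (forall t, Si (S t) = t) ->
    (forall n v w t, le v w -> val n w t -> val n v t) ->
    forall w t, rden W T le S Si val a w t.

Definition is_glb (E : R -> Prop) (m : R) : Prop :=
  (forall x, E x -> m <= x) /\ (forall b, (forall x, E x -> b <= x) -> b <= m).

Fixpoint chain {T : Type} (s : T -> T) (f g : T -> R) (n : nat) (t : T) : R :=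
  match n with
  | O => g t
  | S n' => Rmin (f t) (chain s f g n' (s t))
  end.

Definition real_valuation (T : Type) (S Si : T -> T) (V : form -> T -> R) : Prop :=
  (forall n t, 0 <= V (Var n) t <= 1) /\
  (forall a b t, V (And a b) t = Rmin (V a t) (V b t)) /\
  (forall a b t, V (Or a b) t = Rmax (V a t) (V b t)) /\
  (forall a b t, V (Imp a b) t = if Rle_dec (V a t) (V b t) then 1 else V b t) /\
  (forall a b t, V (Coimp a b) t = if Rle_dec (V a t) (V b t) then 0 else V a t) /\
  (forall a t, V (Nx a) t = V a (S t)) /\
  (forall a t, V (Pv a) t = V a (Si t)) /\
  (forall a t, is_glb (fun x => exists n, x = V a (itr S n t)) (V (Gf a) t)) /\
  (forall a t, is_glb (fun x => exists n, x = V a (itr Si n t)) (V (Hp a) t)) /\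
  (forall a b t, is_lub (fun x => exists n, x = chain S (V a) (V b) n t) (V (Until a b) t)) /\
  (forall a b t, is_lub (fun x => exists n, x = chain Si (V a) (V b) n t) (V (Since a b) t)).

Definition GR (a : form) : Prop :=
  forall (T : Type) (S Si : T -> T) (V : form -> T -> R),
    (forall t, S (Si t) = t) -> (forall t, Si (S t) = t) ->
    real_valuation T S Si V ->
    forall t, V a t = 1.

(* Main.v *)
(** The three classes are compared in the cycle GTL => Grel => GR => GTL.

    Grel => GR: given a real-valued model, let the worlds be the reals of (0,1) that are not
    values of subformulas along the orbit considered, and let [w] satisfy [a] iff [w < V a t].

    GR => GTL: an unprovable formula fails in a complete theory, which orders all formulas
    linearly by provable implication; only the finite set Sg of subformulas is remembered, each
    instant being a map from Sg to the reals whose order is realized by some complete theory.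
    Consecutive instants are realized jointly by one theory on Sg and N Sg, where the position
    of a new value inside a gap between old values may be chosen freely.  If G a has value below
    a real c, then the induction axiom provides a path to an instant where a is below c, provided
    that new values are always placed below c whenever possible; dually for U.  Concatenating such
    paths in both time directions gives a model over the integers. *)

Require Import Defs.
From Stdlib Require Import Reals List ZArith Lia Lra Classical ClassicalEpsilon.
From Stdlib Require Import FunctionalExtensionality ProofIrrelevance Cantor.
Import ListNotations.

(** * Natural deduction inside GTL *)

(** A theory orders formulas but names no real number, the values along a path need not stay in a
    finite set, and an infimum need not be attained. So for a formula [A a] of value below [c] one
    can only ask that [a] drop below [c] somewhere, and the induction axiom needs an invariant
    saying that a value is at least [c], although no formula denotes [c]. The substitute is the
    least formula of [Sg] whose value is at least [c]. Which formula this is varies along the path,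
    but only finitely many pairs of an order pattern on [Sg] and a formula exist, so a finite
    disjunction covers them all. If a new value were put at or above [c] without need, no old
    formula of value at least [c] would have to imply it, and the disjunction would not be preserved
    by [N]; this dictates the rule for placing values.

    Order patterns can occur inside formulas because coimplication defines a two-valued operator
    [delta]; theories are therefore taken closed under it. Since infima are only approximated, the
    final path is a limit of finite ones in which each request is served again and again with
    shrinking error. *)

Inductive der (H : list form) : form -> Prop :=
| der_hyp a : In a H -> der H a
| der_gtl a : GTL a -> der H a
| der_mp a b : der H (Imp a b) -> der H a -> der H b.

Definition env4 (a b c d : form) (n : nat) : form :=
  match n with 0 => a | 1 => b | 2 => c | _ => d end.

Lemma gtl_ipc4 A a b c d : ipc_tautology A -> GTL (psubst (env4 a b c d) A).
Proof. apply gtl_ipc. Qed.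

Ltac kripke := intros W le v Hr Ht Hm w; simpl; eauto.

Lemma gtl_k a b : GTL (Imp a (Imp b a)).
Proof.
  refine (gtl_ipc4 (PImp (PVar 0) (PImp (PVar 1) (PVar 0))) a b a a _). kripke.
Qed.

Lemma gtl_s a b c : GTL (Imp (Imp a (Imp b c)) (Imp (Imp a b) (Imp a c))).
Proof.
  refine (gtl_ipc4 (PImp (PImp (PVar 0) (PImp (PVar 1) (PVar 2)))
    (PImp (PImp (PVar 0) (PVar 1)) (PImp (PVar 0) (PVar 2)))) a b c a _).
  intros W le v Hr Ht Hm w; simpl.
  intros u _ Habc u1 L1 Hab u2 L2 Ha. apply (Habc u2); eauto.
Qed.

Lemma gtl_andi a b : GTL (Imp a (Imp b (And a b))).
Proof.
  refine (gtl_ipc4 (PImp (PVar 0) (PImp (PVar 1) (PAnd (PVar 0) (PVar 1)))) a b a a _).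
  kripke.
Qed.

Lemma gtl_ande1 a b : GTL (Imp (And a b) a).
Proof.
  refine (gtl_ipc4 (PImp (PAnd (PVar 0) (PVar 1)) (PVar 0)) a b a a _).
  intros W le v Hr Ht Hm w; simpl; tauto.
Qed.

Lemma gtl_ande2 a b : GTL (Imp (And a b) b).
Proof.
  refine (gtl_ipc4 (PImp (PAnd (PVar 0) (PVar 1)) (PVar 1)) a b a a _).
  intros W le v Hr Ht Hm w; simpl; tauto.
Qed.

Lemma gtl_ori1 a b : GTL (Imp a (Or a b)).
Proof.
  refine (gtl_ipc4 (PImp (PVar 0) (POr (PVar 0) (PVar 1))) a b a a _). kripke.
Qed.

Lemma gtl_ori2 a b : GTL (Imp b (Or a b)).
Proof.
  refine (gtl_ipc4 (PImp (PVar 1) (POr (PVar 0) (PVar 1))) a b a a _). kripke.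
Qed.

Lemma gtl_ore a b c : GTL (Imp (Imp a c) (Imp (Imp b c) (Imp (Or a b) c))).
Proof.
  refine (gtl_ipc4 (PImp (PImp (PVar 0) (PVar 2)) (PImp (PImp (PVar 1) (PVar 2))
    (PImp (POr (PVar 0) (PVar 1)) (PVar 2)))) a b c a _).
  intros W le v Hr Ht Hm w; simpl.
  intros u _ Ha u1 L1 Hb u2 L2 [K|K]; eauto.
Qed.

Lemma gtl_exf a : GTL (Imp fbot a).
Proof.
  refine (gtl_ipc4 (PImp PBot (PVar 0)) a a a a _).
  intros W le v Hr Ht Hm w; simpl; tauto.
Qed.

(** Hypotheses are combined by modus ponens alone; necessitation and the coimplication rules act on
    theorems only and enter through [der_gtl]. This is what makes the deduction theorem true. *)
Lemma der_ded H a b : der (a :: H) b -> der H (Imp a b).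
Proof.
  induction 1 as [b Hb|b Hb|b c H1 IH1 H2 IH2].
  - destruct Hb as [<-|Hb].
    + apply der_mp with (Imp a (Imp a a));
        [apply der_mp with (Imp a (Imp (Imp a a) a))|].
      * apply der_gtl, gtl_s.
      * apply der_gtl, gtl_k.
      * apply der_gtl, gtl_k.
    + apply der_mp with b; [apply der_gtl, gtl_k|now apply der_hyp].
  - apply der_mp with b; [apply der_gtl, gtl_k|now apply der_gtl].
  - apply der_mp with (Imp a b); [apply der_mp with (Imp a (Imp b c))|]; trivial.
    apply der_gtl, gtl_s.
Qed.

Lemma der_nil a : der [] a -> GTL a.
Proof. induction 1; [easy|easy|eapply gtl_mp; eauto]. Qed.

Lemma der_andi H a b : der H a -> der H b -> der H (And a b).
Proof.
  intros Ha Hb. apply der_mp with b; [apply der_mp with a|]; trivial.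
  apply der_gtl, gtl_andi.
Qed.

Lemma der_ande1 H a b : der H (And a b) -> der H a.
Proof. apply der_mp, der_gtl, gtl_ande1. Qed.

Lemma der_ande2 H a b : der H (And a b) -> der H b.
Proof. apply der_mp, der_gtl, gtl_ande2. Qed.

Lemma der_ori1 H a b : der H a -> der H (Or a b).
Proof. apply der_mp, der_gtl, gtl_ori1. Qed.

Lemma der_ori2 H a b : der H b -> der H (Or a b).
Proof. apply der_mp, der_gtl, gtl_ori2. Qed.

Lemma der_ore H a b c : der H (Or a b) -> der (a :: H) c -> der (b :: H) c -> der H c.
Proof.
  intros Hab Ha Hb. apply der_ded in Ha, Hb.
  refine (der_mp _ _ _ (der_mp _ _ _ (der_mp _ _ _ _ Ha) Hb) Hab).
  apply der_gtl, gtl_ore.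
Qed.

Lemma der_exf H a : der H fbot -> der H a.
Proof. apply der_mp, der_gtl, gtl_exf. Qed.

Lemma der_app H a b : GTL (Imp a b) -> der H a -> der H b.
Proof. intros K. now apply der_mp, der_gtl. Qed.

Ltac hyp := apply der_hyp; simpl; tauto.
Ltac by_mp a := apply (der_mp _ a); [hyp|].

Lemma gtl_trans a b c : GTL (Imp a b) -> GTL (Imp b c) -> GTL (Imp a c).
Proof.
  intros H1 H2. apply der_nil, der_ded, (der_app _ b); trivial.
  apply (der_app _ a); trivial. hyp.
Qed.

(** * The crisp operator *)

(** The Baaz operator: in the real-valued semantics its value is 1 where [a] has value 1, and 0
    elsewhere. *)
Definition delta (a : form) : form := fneg (Coimp ftop a).

Lemma gtl_top : GTL ftop.
Proof. apply der_nil, der_ded. hyp. Qed.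

Lemma gtl_delta_nec a : GTL a -> GTL (delta a).
Proof.
  intros Ha. apply gtl_r2. apply der_nil, der_ded, der_ori1, der_gtl, Ha.
Qed.

Lemma gtl_delta_t a : GTL (Imp (delta a) a).
Proof.
  apply der_nil, der_ded. apply der_ore with a (Coimp ftop a).
  - apply (der_app _ ftop), der_gtl, gtl_top. apply gtl_coimp.
  - hyp.
  - apply der_exf. by_mp (Coimp ftop a). hyp.
Qed.

Lemma gtl_wlem k : GTL (Or (fneg k) (fneg (fneg k))).
Proof.
  apply der_nil. apply der_ore with (Imp k (fneg k)) (Imp (fneg k) k).
  - apply der_gtl, gtl_lin.
  - apply der_ori1, der_ded. apply (der_mp _ k); [|hyp]. by_mp k. hyp.
  - apply der_ori2, der_ded. by_mp k. by_mp (fneg k). hyp.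
Qed.

(** [delta a] is itself a negation, so weak excluded middle decides it. *)
Lemma gtl_delta_em a : GTL (Or (delta a) (fneg (delta a))).
Proof. apply gtl_wlem. Qed.

Lemma gtl_delta_k a b : GTL (Imp (delta (Imp a b)) (Imp (delta a) (delta b))).
Proof.
  (* Dual form of modus ponens: by [gtl_r2] it suffices to obtain, from [ftop], either [b] or the
     failure of one of the two premises. *)
  assert (K : GTL (Imp (Coimp ftop b) (Or (Coimp ftop a) (Coimp ftop (Imp a b))))).
  { apply gtl_r2, der_nil, der_ded.
    apply der_ore with a (Coimp ftop a);
      [apply (der_app _ ftop); [apply gtl_coimp|hyp]| |apply der_ori2, der_ori1; hyp].
    apply der_ore with (Imp a b) (Coimp ftop (Imp a b));
      [apply (der_app _ ftop); [apply gtl_coimp|hyp]| |do 2 apply der_ori2; hyp].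
    apply der_ori1. by_mp a. hyp. }
  apply der_nil. do 3 apply der_ded.
  eapply der_ore; [apply (der_app _ _ _ K); hyp| |].
  - by_mp (Coimp ftop a). hyp.
  - by_mp (Coimp ftop (Imp a b)). hyp.
Qed.

Lemma gtl_delta_mono a b : GTL (Imp a b) -> GTL (Imp (delta a) (delta b)).
Proof.
  intros H. eapply gtl_mp; [apply gtl_delta_k|]. now apply gtl_delta_nec.
Qed.

(** An internal substitute for [gtl_r2], which acts on theorems only: a comparison that merely
    belongs to a theory can thus refute the coimplication. *)
Lemma gtl_coimp_delta a b : GTL (Imp (delta (Imp a b)) (fneg (Coimp a b))).
Proof.
  assert (K : GTL (Imp (Coimp a b) (Coimp ftop (Imp a b)))).
  { apply gtl_r2, der_nil, der_ded.
    apply der_ore with (Imp a b) (Coimp ftop (Imp a b)).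
    - apply (der_app _ ftop); [apply gtl_coimp|apply der_gtl, gtl_top].
    - apply der_ori1. by_mp a. hyp.
    - apply der_ori2. hyp. }
  apply der_nil. do 2 apply der_ded. by_mp (Coimp ftop (Imp a b)).
  apply (der_app _ _ _ K). hyp.
Qed.

Lemma gtl_demorgan p q : GTL (fneg (And p q)) -> GTL (Or (fneg p) (fneg q)).
Proof.
  intros K. apply der_nil. apply der_ore with (Imp p q) (Imp q p).
  - apply der_gtl, gtl_lin.
  - apply der_ori1, der_ded, (der_app _ _ _ K), der_andi; [hyp|]. by_mp p. hyp.
  - apply der_ori2, der_ded, (der_app _ _ _ K), der_andi; [|hyp]. by_mp q. hyp.
Qed.

Lemma gtl_delta_or_aux a b :
  GTL (Imp (delta (Or a b)) (Imp (fneg (Coimp a b)) (delta b))).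
Proof.
  assert (K : GTL (Imp (Coimp ftop b) (Or (Coimp a b) (Coimp ftop (Or a b))))).
  { apply gtl_r2, der_nil, der_ded.
    apply der_ore with (Or a b) (Coimp ftop (Or a b));
      [apply (der_app _ ftop); [apply gtl_coimp|hyp]| |do 2 apply der_ori2; hyp].
    apply der_ore with a b; [hyp| |apply der_ori1; hyp].
    apply der_ore with b (Coimp a b);
      [apply (der_app _ a); [apply gtl_coimp|hyp]|apply der_ori1; hyp|].
    apply der_ori2, der_ori1. hyp. }
  apply der_nil. do 3 apply der_ded.
  eapply der_ore; [apply (der_app _ _ _ K); hyp| |].
  - by_mp (Coimp a b). hyp.
  - by_mp (Coimp ftop (Or a b)). hyp.
Qed.

(** By [gtl_colin] one of the two coimplications is refuted, so one disjunct lies below the other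
    and the disjunction is no stronger than the larger one. Primeness of complete theories rests on
    this. *)
Lemma gtl_delta_or a b : GTL (Imp (delta (Or a b)) (Or (delta a) (delta b))).
Proof.
  apply der_nil, der_ded.
  apply der_ore with (fneg (Coimp a b)) (fneg (Coimp b a)).
  - apply der_gtl, gtl_demorgan, gtl_colin.
  - apply der_ori2. apply (der_mp _ (fneg (Coimp a b))); [|hyp].
    apply (der_app _ _ _ (gtl_delta_or_aux a b)). hyp.
  - apply der_ori1. apply (der_mp _ (fneg (Coimp b a))); [|hyp].
    apply (der_app _ _ _ (gtl_delta_or_aux b a)).
    apply (der_app _ (delta (Or a b))); [|hyp].
    apply gtl_delta_mono, der_nil, der_ded, der_ore with a b;
      [hyp|apply der_ori2; hyp|apply der_ori1; hyp].
Qed.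

Definition crisp (g : form) : Prop := GTL (Imp g (delta g)).

Lemma gtl_delta_em' a : GTL (Or (delta (delta a)) (delta (fneg (delta a)))).
Proof.
  eapply gtl_mp; [apply gtl_delta_or|]. apply gtl_delta_nec, gtl_delta_em.
Qed.

Lemma crisp_delta a : crisp (delta a).
Proof.
  apply der_nil, der_ded.
  apply (der_ore _ _ _ _ (der_gtl _ _ (gtl_delta_em' a))); [hyp|].
  apply der_exf. apply (der_mp _ (delta a)); [|hyp].
  apply (der_app _ _ _ (gtl_delta_t _)). hyp.
Qed.

Lemma crisp_ndelta a : crisp (fneg (delta a)).
Proof.
  apply der_nil, der_ded.
  apply (der_ore _ _ _ _ (der_gtl _ _ (gtl_delta_em' a))); [|hyp].
  apply der_exf. by_mp (delta a).
  apply (der_app _ _ _ (gtl_delta_t _)). hyp.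
Qed.

Lemma crisp_and g h : crisp g -> crisp h -> crisp (And g h).
Proof.
  intros Hg Hh. apply der_nil, der_ded.
  assert (K : GTL (Imp (delta g) (Imp (delta h) (delta (And g h))))).
  { eapply gtl_trans; [|apply gtl_delta_k]. apply gtl_delta_mono, gtl_andi. }
  refine (der_mp _ _ _ (der_app _ _ _ K (der_app _ _ _ Hg _)) (der_app _ _ _ Hh _)).
  - apply der_ande1 with h. hyp.
  - apply der_ande2 with g. hyp.
Qed.

(** * Complete crisp theories *)

(** Closure under [delta] makes membership two-valued, so that [Gam (Imp a b)] is a linear preorder
    of values with the members of [Gam] at the top. *)
Record cth (Gam : form -> Prop) : Prop := {
  cth_gtl : forall a, GTL a -> Gam a;
  cth_mp : forall a b, Gam (Imp a b) -> Gam a -> Gam b;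
  cth_delta : forall a, Gam a -> Gam (delta a);
  cth_dec : forall a, Gam a \/ Gam (fneg (delta a));
  cth_con : ~ Gam fbot }.

Fixpoint forms (n : nat) : list form :=
  match n with
  | 0 => []
  | S n => Var n :: forms n ++
      flat_map (fun a => [Nx a; Pv a; Gf a; Hp a] ++
        flat_map (fun b => [And a b; Or a b; Imp a b; Coimp a b; Until a b; Since a b])
          (forms n)) (forms n)
  end.

Lemma forms_mono n m a : (n <= m)%nat -> In a (forms n) -> In a (forms m).
Proof.
  induction 1 as [|m Hm IH]; trivial. intros Ha. right. apply in_or_app. auto.
Qed.

Lemma forms_all a : exists n, In a (forms n).
Proof.
  assert (U : forall f, In f [Nx; Pv; Gf; Hp] ->
    forall a, (exists n, In a (forms n)) -> exists n, In (f a) (forms n)).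
  { intros f Hf a0 [n Hn]. exists (S n). right. apply in_or_app; right.
    apply in_flat_map. exists a0; split; trivial. apply in_or_app; left.
    change (In (f a0) (map (fun f => f a0) [Nx; Pv; Gf; Hp])).
    now apply (in_map (fun f => f a0)). }
  assert (B : forall f, In f [And; Or; Imp; Coimp; Until; Since] ->
    forall a b, (exists n, In a (forms n)) -> (exists n, In b (forms n)) ->
    exists n, In (f a b) (forms n)).
  { intros f Hf a0 b [n Hn] [m Hm]. exists (S (n + m)%nat). right. apply in_or_app; right.
    apply in_flat_map. exists a0; split; [eapply forms_mono; [|eassumption]; lia|].
    apply in_or_app; right. apply in_flat_map.
    exists b; split; [eapply forms_mono; [|eassumption]; lia|].
    change (In (f a0 b) (map (fun f => f a0 b) [And; Or; Imp; Coimp; Until; Since])).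
    now apply (in_map (fun f => f a0 b)). }
  induction a; [exists (S n); now left|..];
    first [apply U; trivial; simpl; tauto | apply B; trivial; simpl; tauto].
Qed.

Definition con (g : form) : Prop := ~ GTL (Imp g fbot).

(** [delta a] is added rather than [a] so that the accumulated conjunction stays crisp: the
    consequences of a crisp premise are closed under [delta]. *)
Definition extend (g a : form) : form :=
  if excluded_middle_informative (con (And g (delta a)))
  then And g (delta a) else And g (fneg (delta a)).

Lemma extend_spec g a : con g -> crisp g ->
  con (extend g a) /\ crisp (extend g a) /\ GTL (Imp (extend g a) g) /\
  (GTL (Imp (extend g a) a) \/ GTL (Imp (extend g a) (fneg (delta a)))).
Proof.
  intros Hc Hd. unfold extend.
  destruct excluded_middle_informative as [K|K].
  - split; [trivial|split; [|split]].
    + apply crisp_and; [trivial|apply crisp_delta].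
    + apply gtl_ande1.
    + left. eapply gtl_trans; [apply gtl_ande2|apply gtl_delta_t].
  - split; [|split; [|split]].
    + apply NNPP in K. intros K'. apply Hc, der_nil, der_ded.
      apply (der_ore _ _ _ _ (der_gtl _ _ (gtl_delta_em a))).
      * apply (der_app _ _ _ K), der_andi; hyp.
      * apply (der_app _ _ _ K'), der_andi; hyp.
    + apply crisp_and; [trivial|apply crisp_ndelta].
    + apply gtl_ande1.
    + right. apply gtl_ande2.
Qed.

Lemma extend_list_spec l : forall g, con g -> crisp g ->
  con (fold_left extend l g) /\ crisp (fold_left extend l g) /\
  GTL (Imp (fold_left extend l g) g) /\
  (forall a, In a l -> GTL (Imp (fold_left extend l g) a) \/
                       GTL (Imp (fold_left extend l g) (fneg (delta a)))).
Proof.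
  induction l as [|x l IH]; intros g Hc Hd; simpl.
  - repeat split; trivial; [|tauto]. apply der_nil, der_ded. hyp.
  - destruct (extend_spec g x Hc Hd) as (Kc & Kd & Kg & Ka).
    destruct (IH _ Kc Kd) as (Jc & Jd & Jg & Ja).
    repeat split; trivial; [eapply gtl_trans; eauto|].
    intros a [<-|Ha]; [|auto].
    destruct Ka as [Ka|Ka]; [left|right]; eapply gtl_trans; eauto.
Qed.

Fixpoint lindenbaum (g : form) (n : nat) : form :=
  match n with
  | 0 => g
  | S n => fold_left extend (forms n) (lindenbaum g n)
  end.

Lemma lindenbaum_spec g n : con g -> crisp g ->
  con (lindenbaum g n) /\ crisp (lindenbaum g n).
Proof.
  intros Hc Hd. induction n as [|n [IH1 IH2]]; simpl; [now split|].
  destruct (extend_list_spec (forms n) _ IH1 IH2) as (? & ? & _). now split.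
Qed.

Lemma lindenbaum_mono g n m : con g -> crisp g -> (n <= m)%nat ->
  GTL (Imp (lindenbaum g m) (lindenbaum g n)).
Proof.
  intros Hc Hd. induction 1 as [|m Hm IH].
  - apply der_nil, der_ded. hyp.
  - eapply gtl_trans; [|exact IH]. simpl.
    destruct (lindenbaum_spec g m Hc Hd) as [K1 K2].
    apply (extend_list_spec (forms m) _ K1 K2).
Qed.

Lemma cth_exists g : con g -> crisp g -> exists Gam, cth Gam /\ Gam g.
Proof.
  intros Hc Hd. exists (fun a => exists n, GTL (Imp (lindenbaum g n) a)).
  split; [split|].
  - intros a Ha. exists 0%nat. apply der_nil, der_ded, der_gtl, Ha.
  - intros a b [n Hn] [m Hm]. exists (n + m)%nat.
    apply der_nil, der_ded. apply (der_mp _ a).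
    + apply (der_app _ _ _ Hn), (der_app _ (lindenbaum g (n + m)%nat)); [|hyp].
      apply lindenbaum_mono; trivial; lia.
    + apply (der_app _ _ _ Hm), (der_app _ (lindenbaum g (n + m)%nat)); [|hyp].
      apply lindenbaum_mono; trivial; lia.
  - intros a [n Hn]. exists n.
    eapply gtl_trans; [apply (lindenbaum_spec g n Hc Hd)|].
    now apply gtl_delta_mono.
  - intros a. destruct (forms_all a) as [n Hn].
    destruct (lindenbaum_spec g n Hc Hd) as [K1 K2].
    destruct (extend_list_spec (forms n) _ K1 K2) as (_ & _ & _ & K).
    destruct (K a Hn); [left|right]; now exists (S n).
  - intros [n Hn]. now apply (proj1 (lindenbaum_spec g n Hc Hd)).
  - exists 0%nat. apply der_nil, der_ded. hyp.
Qed.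

(** If [fneg (delta a)] were inconsistent, excluded middle for [delta a] would prove [a]. *)
Lemma gtl_complete a : (forall Gam, cth Gam -> Gam a) -> GTL a.
Proof.
  intros H. apply NNPP. intros Ha.
  destruct (cth_exists (fneg (delta a))) as (Gam & HG & Hn).
  - intros K. apply Ha. apply der_nil, (der_app _ _ _ (gtl_delta_t a)).
    apply (der_ore _ _ _ _ (der_gtl _ _ (gtl_delta_em a))); [hyp|].
    apply der_exf, (der_app _ _ _ K). hyp.
  - apply crisp_ndelta.
  - apply (cth_con _ HG), (cth_mp _ HG _ _ Hn), (cth_delta _ HG), H, HG.
Qed.

(** * Complete theories as linear orders of formulas *)

Section CompleteTheory.
Variable Gam : form -> Prop.
Hypothesis HG : cth Gam.

Lemma cth_der H a : der H a -> (forall x, In x H -> Gam x) -> Gam a.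
Proof.
  intros D K. induction D; [auto|now apply (cth_gtl _ HG)|].
  eapply (cth_mp _ HG); eauto.
Qed.

Lemma cth_app a b : GTL (Imp a b) -> Gam a -> Gam b.
Proof. intros K. now apply (cth_mp _ HG), (cth_gtl _ HG). Qed.

Lemma cth_and a b : Gam (And a b) <-> Gam a /\ Gam b.
Proof.
  split.
  - intros H; split; revert H; apply cth_app; [apply gtl_ande1|apply gtl_ande2].
  - intros [Ha Hb]. apply (cth_der [a; b]); [apply der_andi; hyp|].
    intros x [<-|[<-|[]]]; trivial.
Qed.

Lemma cth_or a b : Gam (Or a b) <-> Gam a \/ Gam b.
Proof.
  split.
  - intros H.
    destruct (cth_dec _ HG a) as [Ha|Ha]; [now left|].
    destruct (cth_dec _ HG b) as [Hb|Hb]; [now right|].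
    destruct (cth_con _ HG).
    apply (cth_der [Or (delta a) (delta b); fneg (delta a); fneg (delta b)]).
    + apply der_ore with (delta a) (delta b); [hyp|by_mp (delta a); hyp|by_mp (delta b); hyp].
    + intros x [<-|[<-|[<-|[]]]]; trivial.
      apply (cth_app _ _ (gtl_delta_or a b)). now apply (cth_delta _ HG).
  - intros [H|H]; revert H; apply cth_app; [apply gtl_ori1|apply gtl_ori2].
Qed.

Lemma cth_ndelta a : Gam (fneg (delta a)) <-> ~ Gam a.
Proof.
  split.
  - intros H Ha. apply (cth_con _ HG), (cth_mp _ HG _ _ H), (cth_delta _ HG), Ha.
  - intros H. destruct (cth_dec _ HG a); tauto.
Qed.

Lemma cth_deltaE a : Gam (delta a) <-> Gam a.
Proof. split; [apply cth_app, gtl_delta_t|apply (cth_delta _ HG)]. Qed.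

Lemma cth_refl a : Gam (Imp a a).
Proof. apply (cth_gtl _ HG), der_nil, der_ded. hyp. Qed.

Lemma cth_trans a b c : Gam (Imp a b) -> Gam (Imp b c) -> Gam (Imp a c).
Proof.
  intros H1 H2. apply (cth_der [Imp a b; Imp b c]).
  - apply der_ded. by_mp b. by_mp a. hyp.
  - intros x [<-|[<-|[]]]; trivial.
Qed.

Lemma cth_total a b : Gam (Imp a b) \/ Gam (Imp b a).
Proof. apply cth_or, (cth_gtl _ HG), gtl_lin. Qed.

Lemma cth_top a : Gam (Imp a ftop).
Proof. apply (cth_gtl _ HG), der_nil, der_ded, der_gtl, gtl_top. Qed.

Lemma cth_bot a : Gam (Imp fbot a).
Proof. apply (cth_gtl _ HG), gtl_exf. Qed.

Lemma cth_true a b : Gam b -> Gam (Imp a b).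
Proof. apply cth_app, gtl_k. Qed.

Lemma cth_imp_and a b c : Gam (Imp c (And a b)) <-> Gam (Imp c a) /\ Gam (Imp c b).
Proof.
  split.
  - intros H; split; apply (cth_trans _ _ _ H), (cth_gtl _ HG);
      [apply gtl_ande1|apply gtl_ande2].
  - intros [H1 H2]. apply (cth_der [Imp c a; Imp c b]).
    + apply der_ded, der_andi; by_mp c; hyp.
    + intros x [<-|[<-|[]]]; trivial.
Qed.

Lemma cth_and_l a b : Gam (Imp (And a b) a).
Proof. apply (cth_gtl _ HG), gtl_ande1. Qed.

Lemma cth_and_r a b : Gam (Imp (And a b) b).
Proof. apply (cth_gtl _ HG), gtl_ande2. Qed.

Lemma cth_or_l a b : Gam (Imp a (Or a b)).
Proof. apply (cth_gtl _ HG), gtl_ori1. Qed.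

Lemma cth_or_r a b : Gam (Imp b (Or a b)).
Proof. apply (cth_gtl _ HG), gtl_ori2. Qed.

Lemma cth_or_imp a b c : Gam (Imp (Or a b) c) <-> Gam (Imp a c) /\ Gam (Imp b c).
Proof.
  split.
  - intros H; split; apply (fun K => cth_trans _ _ _ K H); [apply cth_or_l|apply cth_or_r].
  - intros [H1 H2]. apply (cth_der [Imp a c; Imp b c]).
    + apply der_ded, der_ore with a b; [hyp|by_mp a; hyp|by_mp b; hyp].
    + intros x [<-|[<-|[]]]; trivial.
Qed.

Lemma cth_imp_le a b : ~ Gam (Imp a b) -> Gam (Imp (Imp a b) b).
Proof.
  (* Contraction rules out the first case; in the second, [Imp a b] yields [a] and hence [b]. *)
  intros H. destruct (cth_total a (Imp a b)) as [K|K].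
  - destruct H. apply (cth_der [Imp a (Imp a b)]).
    + apply der_ded, (der_mp _ a); [by_mp a|]; hyp.
    + intros x [<-|[]]; trivial.
  - apply (cth_der [Imp (Imp a b) a]).
    + apply der_ded. by_mp a. by_mp (Imp a b). hyp.
    + intros x [<-|[]]; trivial.
Qed.

Lemma cth_coimp_bot a b : Gam (Imp a b) -> Gam (Imp (Coimp a b) fbot).
Proof. intros H. apply (cth_app _ _ (gtl_coimp_delta a b)), (cth_delta _ HG), H. Qed.

Lemma cth_coimp_le a b : Gam (Imp (Coimp a b) a).
Proof. apply (cth_gtl _ HG), gtl_r2, gtl_ori2. Qed.

Lemma cth_coimp_ge a b : ~ Gam (Imp a b) -> Gam (Imp a (Coimp a b)).
Proof.
  intros H. assert (K := cth_gtl _ HG _ (gtl_coimp a b)).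
  destruct (cth_total b (Coimp a b)) as [L|L].
  - apply (cth_trans _ _ _ K), cth_or_imp. split; [trivial|apply cth_refl].
  - destruct H. apply (cth_trans _ _ _ K), cth_or_imp. split; [apply cth_refl|trivial].
Qed.

End CompleteTheory.

(** * Finite joins, finite meets and crisp descriptions *)

Fixpoint bigor (l : list form) : form :=
  match l with [] => fbot | x :: l => Or x (bigor l) end.

Fixpoint bigand (l : list form) : form :=
  match l with [] => ftop | x :: l => And x (bigand l) end.

Lemma cth_bigor_imp Gam l c : cth Gam ->
  (forall x, In x l -> Gam (Imp x c)) -> Gam (Imp (bigor l) c).
Proof.
  intros HG. induction l as [|x l IH]; simpl; intros H; [now apply cth_bot|].
  apply cth_or_imp; auto.
Qed.

Lemma cth_imp_bigor Gam l x : cth Gam -> In x l -> Gam (Imp x (bigor l)).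
Proof.
  intros HG. induction l as [|y l IH]; simpl; [easy|]. intros [->|H].
  - now apply cth_or_l.
  - apply cth_trans with (bigor l); auto. now apply cth_or_r.
Qed.

Lemma cth_imp_bigand Gam l c : cth Gam ->
  (forall x, In x l -> Gam (Imp c x)) -> Gam (Imp c (bigand l)).
Proof.
  intros HG. induction l as [|x l IH]; simpl; intros H; [now apply cth_top|].
  apply cth_imp_and; auto.
Qed.

Lemma cth_bigand_imp Gam l x : cth Gam -> In x l -> Gam (Imp (bigand l) x).
Proof.
  intros HG. induction l as [|y l IH]; simpl; [easy|]. intros [->|H].
  - now apply cth_and_l.
  - apply cth_trans with (bigand l); auto. now apply cth_and_r.
Qed.

(* Each formula of [chars l] decides, for every member of [l], whether its value is 1. *)
Fixpoint chars (l : list form) : list form :=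
  match l with
  | [] => [ftop]
  | p :: l => flat_map (fun x => [And (delta p) x; And (fneg (delta p)) x]) (chars l)
  end.

Lemma chars_exists Gam l : cth Gam -> exists x, In x (chars l) /\ Gam x.
Proof.
  intros HG. induction l as [|p l (x & Hx & Kx)]; simpl.
  - exists ftop. split; [now left|]. apply (cth_gtl _ HG), gtl_top.
  - destruct (classic (Gam p)) as [K|K].
    + exists (And (delta p) x). split.
      * apply in_flat_map. exists x; simpl; tauto.
      * apply cth_and; trivial. split; [now apply cth_deltaE|trivial].
    + exists (And (fneg (delta p)) x). split.
      * apply in_flat_map. exists x; simpl; tauto.
      * apply cth_and; trivial. split; [now apply cth_ndelta|trivial].
Qed.

Lemma chars_agree Gam Gam' l x : cth Gam -> cth Gam' -> In x (chars l) ->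
  Gam x -> Gam' x -> forall p, In p l -> (Gam p <-> Gam' p).
Proof.
  intros HG HG'. revert x. induction l as [|q l IH]; simpl; [easy|].
  intros x Hx K K' p Hp. apply in_flat_map in Hx as (y & Hy & Hx).
  destruct Hx as [<-|[<-|[]]]; apply cth_and in K as [K1 K2]; trivial;
    apply cth_and in K' as [K1' K2']; trivial;
    (destruct Hp as [<-|Hp]; [|now apply (IH y)]).
  - apply (proj1 (cth_deltaE _ HG _)) in K1. apply (proj1 (cth_deltaE _ HG' _)) in K1'.
    tauto.
  - apply (cth_ndelta _ HG) in K1. apply (cth_ndelta _ HG') in K1'. tauto.
Qed.

(** A description is a conjunction of crisp conditions, so every theory affirms or refutes it.
    Conjoined with a formula [d] it is therefore equivalent, in the theory, to [d] or to bottom. *)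
Lemma chars_dec Gam l x : cth Gam -> In x (chars l) -> Gam x \/ Gam (fneg x).
Proof.
  intros HG. revert x. induction l as [|q l IH]; simpl; intros x Hx.
  - destruct Hx as [<-|[]]. left. apply (cth_gtl _ HG), gtl_top.
  - apply in_flat_map in Hx as (y & Hy & Hx).
    assert (N : forall p, Gam (fneg p) \/ Gam (fneg y) -> Gam (fneg (And p y))).
    { intros p [K|K]; refine (cth_trans _ HG _ _ _ _ K);
        [now apply cth_and_l|now apply cth_and_r]. }
    destruct (IH y Hy) as [K|K].
    2: { right. destruct Hx as [<-|[<-|[]]]; apply N; now right. }
    destruct (classic (Gam q)) as [L|L]; destruct Hx as [<-|[<-|[]]].
    + left. apply cth_and; trivial. split; [now apply cth_deltaE|trivial].
    + right. apply N. left. apply (cth_der _ HG [delta q]).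
      * apply der_ded. by_mp (delta q). hyp.
      * intros z [<-|[]]. now apply cth_deltaE.
    + right. apply N. left. now apply cth_ndelta.
    + left. apply cth_and; trivial. split; [now apply cth_ndelta|trivial].
Qed.
(** * Values of finitely many formulas at one or two instants *)

(** Abstracts from the direction of time, so that each construction is made once and used for both.
    The clauses on the inverse [P] serve to move [N] across coimplication. *)
Record tense (N P A : form -> form) (U : form -> form -> form) : Prop := {
  tense_ax : forall a, tense_axiom N A U a -> GTL a;
  tense_np : forall a, GTL (fiff a (N (P a)));
  tense_pn : forall a, GTL (fiff a (P (N a)));
  tense_nec : forall a, GTL a -> GTL (N a);
  tense_necP : forall a, GTL a -> GTL (P a);
  tense_necA : forall a, GTL a -> GTL (A a);
  tense_Pimp : forall a b, GTL (fiff (P (Imp a b)) (Imp (P a) (P b)));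
  tense_Por : forall a b, GTL (Imp (P (Or a b)) (Or (P a) (P b))) }.

Lemma tense_future : tense Nx Pv Gf Until.
Proof.
  split; try (intros; constructor; trivial; fail).
  - intros a b. apply gtl_past, ta_nimp.
  - intros a b. apply gtl_past, ta_nor.
Qed.

Lemma tense_past : tense Pv Nx Hp Since.
Proof.
  split; try (intros; constructor; trivial; fail).
  - intros a b. apply gtl_future, ta_nimp.
  - intros a b. apply gtl_future, ta_nor.
Qed.

(** [v] induces an order embedding into the reals of [L] modulo equivalence in [Gam]. *)
Definition emb (Gam : form -> Prop) (L : list form) (v : form -> R) : Prop :=
  forall x y, In x L -> In y L -> (v x <= v y <-> Gam (Imp x y)).

Lemma finite_max (P : form -> Prop) (v : form -> R) L :
  (exists x, In x L /\ P x) ->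
  exists x, In x L /\ P x /\ forall y, In y L -> P y -> v y <= v x.
Proof.
  induction L as [|a L IH]; intros (x & Hx & Px); [easy|].
  destruct (classic (exists x, In x L /\ P x)) as [K|K].
  - destruct (IH K) as (m & Hm & Pm & Km).
    destruct (classic (P a)) as [Pa|Pa].
    + destruct (Rle_lt_dec (v a) (v m)) as [J|J].
      * exists m. split; [now right|]. split; trivial. intros y [<-|Hy]; auto.
      * exists a. split; [now left|]. split; trivial.
        intros y [<-|Hy] Py; [lra|]. specialize (Km y Hy Py). lra.
    + exists m. split; [now right|]. split; trivial. intros y [<-|Hy]; [tauto|auto].
  - assert (E : forall y, In y (a :: L) -> P y -> a = y).
    { intros y [Hy|Hy] Py; trivial. destruct K; eauto. }
    exists a. split; [now left|]. split; [now rewrite (E x)|].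
    intros y Hy Py. rewrite (E y); trivial. lra.
Qed.

Lemma finite_min (P : form -> Prop) (v : form -> R) L :
  (exists x, In x L /\ P x) ->
  exists x, In x L /\ P x /\ forall y, In y L -> P y -> v x <= v y.
Proof.
  intros H. destruct (finite_max P (fun x => - v x) L H) as (x & Hx & Px & K).
  exists x. repeat split; trivial. intros y Hy Py. specialize (K y Hy Py). lra.
Qed.

Definition upd (v : form -> R) (e : form) (r : R) (x : form) : R :=
  if excluded_middle_informative (x = e) then r else v x.

Lemma upd_same v e r : upd v e r e = r.
Proof. unfold upd. now destruct excluded_middle_informative. Qed.

Lemma upd_other v e r x : x <> e -> upd v e r x = v x.
Proof. unfold upd. now destruct excluded_middle_informative. Qed.

Lemma emb_cons Gam L v e r : cth Gam -> emb Gam L v -> ~ In e L ->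
  (forall y, In y L -> (r <= v y <-> Gam (Imp e y)) /\ (v y <= r <-> Gam (Imp y e))) ->
  emb Gam (e :: L) (upd v e r).
Proof.
  intros HG Hv He H.
  assert (O : forall y, In y L -> upd v e r y = v y).
  { intros y Hy. apply upd_other. now intros ->. }
  intros x y [<-|Hx] [<-|Hy]; rewrite ?upd_same, ?O; trivial.
  - split; intros _; [now apply cth_refl|lra].
  - now apply H.
  - now apply H.
  - now apply Hv.
Qed.

(** The bounds are the largest old value below [e] and the least old value above it. If they met,
    [e] would be equivalent to an old formula; otherwise no old value lies strictly between them and
    every interior point serves. *)
Lemma emb_gap Gam L v e : cth Gam -> In ftop L -> In fbot L -> emb Gam L v ->
  ~ (exists d, In d L /\ Gam (Imp d e) /\ Gam (Imp e d)) ->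
  exists lo hi, In lo L /\ In hi L /\ v lo < v hi /\ Gam (Imp lo e) /\ Gam (Imp e hi) /\
    forall r, v lo < r < v hi -> emb Gam (e :: L) (upd v e r).
Proof.
  intros HG Ht Hb Hv Hn.
  destruct (finite_max (fun x => Gam (Imp x e)) v L) as (lo & Hlo & Klo & Mlo).
  { exists fbot. split; trivial. now apply cth_bot. }
  destruct (finite_min (fun x => Gam (Imp e x)) v L) as (hi & Hhi & Khi & Mhi).
  { exists ftop. split; trivial. now apply cth_top. }
  assert (Hlt : v lo < v hi).
  { destruct (Rlt_le_dec (v lo) (v hi)) as [J|J]; trivial.
    destruct Hn. exists lo. repeat split; trivial.
    apply cth_trans with hi; trivial. now apply Hv. }
  exists lo, hi. do 5 (split; [trivial|]).
  intros r Hr. apply emb_cons; trivial.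
  { intros He. apply Hn. exists e. repeat split; trivial; now apply cth_refl. }
  intros y Hy. split; split; intros K.
  - destruct (cth_total _ HG e y) as [J|J]; trivial.
    specialize (Mlo y Hy J). lra.
  - specialize (Mhi y Hy K). lra.
  - destruct (cth_total _ HG e y) as [J|J]; trivial.
    specialize (Mhi y Hy J). lra.
  - specialize (Mlo y Hy K). lra.
Qed.

(* A new value is placed on a prescribed side of the cut [c] unless an old value prevents it:
   with [low = true] it stays below [c] whenever possible, with [low = false] above. *)
Definition beyond (low : bool) (c x : R) : Prop := if low then c <= x else x <= c.

Definition ordered (low : bool) (Gam : form -> Prop) (d e : form) : Prop :=
  if low then Gam (Imp d e) else Gam (Imp e d).

Lemma ordered_refl low Gam d : cth Gam -> ordered low Gam d d.
Proof. intros HG. destruct low; simpl; now apply cth_refl. Qed.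

Lemma ordered_trans low Gam d e f : cth Gam ->
  ordered low Gam d e -> ordered low Gam e f -> ordered low Gam d f.
Proof. intros HG. destruct low; simpl; intros; eapply cth_trans; eauto. Qed.

Lemma emb_insert low c Gam L v e : cth Gam -> In ftop L -> In fbot L -> emb Gam L v ->
  exists v', emb Gam (e :: L) v' /\ (forall x, In x L -> v' x = v x) /\
    (beyond low c (v' e) -> exists d, In d L /\ beyond low c (v d) /\ ordered low Gam d e).
Proof.
  intros HG Ht Hb Hv.
  destruct (classic (In e L)) as [He|He].
  { exists v. split; [|split; trivial].
    - intros x y Hx Hy. apply Hv; [destruct Hx as [<-|]|destruct Hy as [<-|]]; trivial.
    - intros K. exists e. repeat split; trivial. now apply ordered_refl. }
  assert (O : forall r x, In x L -> upd v e r x = v x).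
  { intros r x Hx. apply upd_other. now intros ->. }
  destruct (classic (exists d, In d L /\ Gam (Imp d e) /\ Gam (Imp e d)))
    as [(d & Hd & K1 & K2)|K].
  { exists (upd v e (v d)). split; [|split; [now apply O|]].
    - apply emb_cons; trivial. intros y Hy. rewrite (Hv d y), (Hv y d); trivial.
      split; split; intros J; eapply cth_trans; eauto.
    - rewrite upd_same. intros J. exists d. repeat split; trivial. now destruct low. }
  destruct (emb_gap Gam L v e HG Ht Hb Hv K) as (lo & hi & Hlo & Hhi & Hlt & Klo & Khi & E).
  (* If the gap meets the desired side of the cut, [r] is a midpoint taken on that side and the
     premise [beyond] fails; otherwise an endpoint of the gap is the required old formula. *)
  assert (J : exists r, v lo < r < v hi /\
    (beyond low c r -> exists d, In d L /\ beyond low c (v d) /\ ordered low Gam d e)).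
  { destruct low; simpl.
    - destruct (Rlt_le_dec (v lo) c) as [J|J].
      + assert (M := Rmin_l c (v hi)). assert (M' := Rmin_r c (v hi)).
        assert (v lo < Rmin c (v hi)) by now apply Rmin_glb_lt.
        exists ((v lo + Rmin c (v hi)) / 2). split; [lra|]. intros; lra.
      + exists ((v lo + v hi) / 2). split; [lra|]. intros _. now exists lo.
    - destruct (Rlt_le_dec c (v hi)) as [J|J].
      + assert (M := Rmax_l c (v lo)). assert (M' := Rmax_r c (v lo)).
        assert (Rmax c (v lo) < v hi) by now apply Rmax_lub_lt.
        exists ((Rmax c (v lo) + v hi) / 2). split; [lra|]. intros; lra.
      + exists ((v lo + v hi) / 2). split; [lra|]. intros _. now exists hi. }
  destruct J as (r & Hr & Jr). exists (upd v e r).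
  split; [now apply E|]. split; [now apply O|]. now rewrite upd_same.
Qed.

Lemma emb_insert_list low c Gam L M v : cth Gam -> In ftop L -> In fbot L -> emb Gam L v ->
  exists v', emb Gam (M ++ L) v' /\ (forall x, In x L -> v' x = v x) /\
    forall e, In e M -> beyond low c (v' e) ->
      exists d, In d L /\ beyond low c (v d) /\ ordered low Gam d e.
Proof.
  intros HG Ht Hb Hv. induction M as [|m M (w & Hw & Aw & Kw)]; simpl.
  - exists v. repeat split; try tauto; now apply Hv.
  - destruct (emb_insert low c Gam (M ++ L) w m HG) as (v' & Hv' & Av' & Kv'); trivial;
      try (apply in_or_app; now right).
    exists v'. split; [trivial|]. split.
    + intros x Hx. rewrite Av'; [auto|apply in_or_app; now right].
    (* The formula that forces a new value across the cut may itself have been inserted earlier; its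
       own old witness is then passed on by transitivity. *)
    + assert (B : forall d, In d (M ++ L) -> beyond low c (w d) ->
        exists d', In d' L /\ beyond low c (v d') /\ ordered low Gam d' d).
      { intros d Hd Kd. apply in_app_or in Hd as [Hd|Hd]; [now apply Kw|].
        exists d. rewrite <- Aw; trivial. repeat split; trivial. now apply ordered_refl. }
      intros e [<-|He] Ke.
      * destruct (Kv' Ke) as (d & Hd & Kd & Od). destruct (B d Hd Kd) as (d' & ? & ? & ?).
        exists d'. repeat split; trivial. now apply ordered_trans with d.
      * rewrite Av' in Ke; [now apply Kw|apply in_or_app; now left].
Qed.

Definition select {X} (P : X -> Prop) (l : list X) : list X :=
  filter (fun x => if excluded_middle_informative (P x) then true else false) l.

Lemma select_in {X} (P : X -> Prop) l x : In x (select P l) <-> In x l /\ P x.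
Proof.
  unfold select. rewrite filter_In. destruct excluded_middle_informative; intuition discriminate.
Qed.

(** [P] is imposed on every instant of the path except the last, as until demands of its left
    argument. *)
Inductive reach (step : (form -> R) -> (form -> R) -> Prop) (P : (form -> R) -> Prop)
  (f : form -> R) : (form -> R) -> Prop :=
| reach_refl : reach step P f f
| reach_step g h : reach step P f g -> P g -> step g h -> reach step P f h.

(** * Theories across one step of time *)

Section Steps.
Variables (N P A : form -> form) (U : form -> form -> form).
Hypothesis HT : tense N P A U.

Lemma gtl_N_mono a b : GTL (Imp a b) -> GTL (Imp (N a) (N b)).
Proof.
  intros H. eapply gtl_mp; [|apply (tense_nec _ _ _ _ HT), H].
  eapply gtl_mp; [apply gtl_ande1|]. apply (tense_ax _ _ _ _ HT), ta_nimp.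
Qed.

Lemma gtl_P_mono a b : GTL (Imp a b) -> GTL (Imp (P a) (P b)).
Proof.
  intros H. eapply gtl_mp; [|apply (tense_necP _ _ _ _ HT), H].
  eapply gtl_mp; [apply gtl_ande1|]. apply (tense_Pimp _ _ _ _ HT).
Qed.

Lemma gtl_iff_l a b : GTL (fiff a b) -> GTL (Imp a b).
Proof. apply gtl_mp, gtl_ande1. Qed.

Lemma gtl_iff_r a b : GTL (fiff a b) -> GTL (Imp b a).
Proof. apply gtl_mp, gtl_ande2. Qed.

(* Conjugating by the inverse [P] of [N] reduces this to the rules for coimplication. *)
Lemma gtl_N_coimp a b : GTL (Imp (N (Coimp a b)) (Coimp (N a) (N b))).
Proof.
  eapply gtl_trans; [|apply gtl_iff_r, (tense_np _ _ _ _ HT)].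
  apply gtl_N_mono, gtl_r2.
  eapply gtl_trans; [apply gtl_iff_l, (tense_pn _ _ _ _ HT)|].
  eapply gtl_trans; [apply gtl_P_mono, (gtl_coimp (N a) (N b))|].
  eapply gtl_trans; [apply (tense_Por _ _ _ _ HT)|].
  apply der_nil, der_ded. eapply der_ore; [hyp| |apply der_ori2; hyp].
  apply der_ori1, (der_app _ (P (N b))); [apply gtl_iff_r, (tense_pn _ _ _ _ HT)|hyp].
Qed.

Lemma gtl_N_delta a : GTL (Imp (delta (N a)) (N (delta a))).
Proof.
  eapply gtl_trans; [|apply gtl_iff_r, (tense_ax _ _ _ _ HT), ta_nimp].
  apply der_nil. do 2 apply der_ded. apply der_exf. by_mp (Coimp ftop (N a)).
  apply (der_app _ (N (Coimp ftop a))); [|hyp].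
  eapply gtl_trans; [apply gtl_N_coimp|]. apply gtl_r1, der_nil, der_ded, der_gtl, gtl_top.
Qed.

Section Theory.
Variable Gam : form -> Prop.
Hypothesis HG : cth Gam.

Lemma cth_N_imp a b : Gam (N (Imp a b)) <-> Gam (Imp (N a) (N b)).
Proof.
  split; apply (cth_app _ HG); [apply gtl_iff_l|apply gtl_iff_r];
    apply (tense_ax _ _ _ _ HT), ta_nimp.
Qed.

(** One theory speaks about all instants: what it says under [N] is a complete theory of the
    adjacent instant. Closure under [delta] is the clause that needs [N] to pass through
    coimplication. *)
Lemma cth_shift : cth (fun a => Gam (N a)).
Proof.
  split.
  - intros a Ha. now apply (cth_gtl _ HG), (tense_nec _ _ _ _ HT).
  - intros a b H. now apply (cth_mp _ HG), cth_N_imp.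
  - intros a Ha. apply (cth_app _ HG _ _ (gtl_N_delta a)), (cth_delta _ HG), Ha.
  - intros a. destruct (classic (Gam (N a))) as [K|K]; [now left|right].
    assert (J : Gam (Or (N (delta a)) (N (fneg (delta a))))).
    { apply (cth_gtl _ HG). eapply gtl_mp; [apply (tense_ax _ _ _ _ HT), ta_nor|].
      apply (tense_nec _ _ _ _ HT), gtl_delta_em. }
    apply cth_or in J as [J|J]; trivial. destruct K. revert J.
    apply (cth_app _ HG), gtl_N_mono, gtl_delta_t.
  - intros K. apply (cth_con _ HG). revert K. apply (cth_app _ HG).
    apply (tense_ax _ _ _ _ HT), ta_nbot.
Qed.

Lemma cth_A_l a : Gam (Imp (A a) a).
Proof.
  apply (cth_gtl _ HG). eapply gtl_trans; [|apply gtl_ande1].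
  apply (tense_ax _ _ _ _ HT), ta_fix.
Qed.

Lemma cth_A_next a : Gam (Imp (A a) (N (A a))).
Proof.
  apply (cth_gtl _ HG). eapply gtl_trans; [|apply gtl_ande2].
  apply (tense_ax _ _ _ _ HT), ta_fix.
Qed.

Lemma gtl_A_ind a b : GTL (Imp a (N a)) -> GTL (Imp a b) -> GTL (Imp a (A b)).
Proof.
  intros H1 H2. eapply gtl_trans.
  - eapply gtl_mp; [apply (tense_ax _ _ _ _ HT), ta_ind|]. now apply (tense_necA _ _ _ _ HT).
  - eapply gtl_mp; [apply (tense_ax _ _ _ _ HT), ta_k|]. now apply (tense_necA _ _ _ _ HT).
Qed.

(** The premise is an invariant: [N (A a)] already yields [N] of the whole conjunction by the
    fixpoint axiom, so induction applies. *)
Lemma cth_A_fold a : Gam (Imp (And a (N (A a))) (A a)).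
Proof.
  apply (cth_gtl _ HG), gtl_A_ind; [|apply gtl_ande1].
  eapply gtl_trans; [apply gtl_ande2|]. apply gtl_N_mono, (tense_ax _ _ _ _ HT), ta_fix.
Qed.

Lemma cth_U_fold a b : Gam (Imp (Or b (And a (N (U a b)))) (U a b)).
Proof. apply (cth_gtl _ HG), (tense_ax _ _ _ _ HT), ta_ufix. Qed.

Lemma gtl_U_ind a b c : GTL (Imp b c) -> GTL (Imp (And a (N c)) c) -> GTL (Imp (U a b) c).
Proof.
  intros H1 H2. eapply gtl_trans.
  - eapply gtl_mp; [apply (tense_ax _ _ _ _ HT), (ta_ur _ _ _ b c)|].
    now apply (tense_necA _ _ _ _ HT).
  - eapply gtl_mp; [apply (tense_ax _ _ _ _ HT), ta_uind|]. now apply (tense_necA _ _ _ _ HT).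
Qed.

(** The right-hand side is a pre-fixed point, and the induction axiom makes [U a b] the least
    one. *)
Lemma cth_U_unfold a b : Gam (Imp (U a b) (Or b (And a (N (U a b))))).
Proof.
  apply (cth_gtl _ HG), gtl_U_ind; [apply gtl_ori1|].
  apply der_nil, der_ded, der_ori2, der_andi.
  { apply der_ande1 with (N (Or b (And a (N (U a b))))). hyp. }
  apply (der_app _ (N (Or b (And a (N (U a b)))))).
  - apply gtl_N_mono, (tense_ax _ _ _ _ HT), ta_ufix.
  - apply der_ande2 with a. hyp.
Qed.

End Theory.

(** * Instants and transitions as real-valued maps *)

Variable Sg : list form.
Hypothesis Htop : In ftop Sg.
Hypothesis Hbot : In fbot Sg.
Hypothesis HA : forall a, In (A a) Sg -> In a Sg.
Hypothesis HU : forall a b, In (U a b) Sg -> In a Sg /\ In b Sg.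

Definition state (f : form -> R) : Prop :=
  f ftop = 1 /\ f fbot = 0 /\ exists Gam, cth Gam /\ emb Gam Sg f.

(** Both instants are measured on one scale, [g a] being the value of [N a] for the same theory. The
    mixed comparisons turn the fixpoint axioms into equations between [f] and [g]. *)
Definition step_by (Gam : form -> Prop) (f g : form -> R) : Prop :=
  forall a b, In a Sg -> In b Sg ->
    (f a <= f b <-> Gam (Imp a b)) /\ (f a <= g b <-> Gam (Imp a (N b))) /\
    (g a <= f b <-> Gam (Imp (N a) b)) /\ (g a <= g b <-> Gam (Imp (N a) (N b))).

Definition step (f g : form -> R) : Prop := exists Gam, cth Gam /\ step_by Gam f g.

Lemma state_bound f a : state f -> In a Sg -> 0 <= f a <= 1.
Proof.
  intros (<- & <- & Gam & HG & He) Ha.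
  split; apply He; trivial; [now apply cth_bot|now apply cth_top].
Qed.

Lemma step_by_emb Gam f g : cth Gam -> step_by Gam f g -> emb (fun a => Gam (N a)) Sg g.
Proof.
  intros HG H a b Ha Hb. rewrite cth_N_imp; trivial. now apply H.
Qed.

Lemma step_state f g : state f -> step f g -> state g.
Proof.
  intros (E1 & E0 & _) (Gam & HG & H). repeat split.
  - apply Rle_antisym; rewrite <- E1; apply (H ftop ftop); trivial.
    + now apply cth_top.
    + apply cth_true; trivial. apply (cth_gtl _ HG), (tense_nec _ _ _ _ HT), gtl_top.
  - apply Rle_antisym; rewrite <- E0; apply (H fbot fbot); trivial.
    + apply (cth_gtl _ HG), (tense_ax _ _ _ _ HT), ta_nbot.
    + now apply cth_bot.
  - exists (fun a => Gam (N a)). split; [now apply cth_shift|now apply step_by_emb with f].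
Qed.

(** The formulas [N a] are inserted among the values of [f], so a next value beyond the cut is
    accounted for by a formula that is beyond it now. *)
Lemma step_exists low c Gam f : cth Gam -> emb Gam Sg f ->
  exists g, step_by Gam f g /\ forall e, In e Sg -> beyond low c (g e) ->
    exists d, In d Sg /\ beyond low c (f d) /\ ordered low Gam d (N e).
Proof.
  intros HG He.
  destruct (emb_insert_list low c Gam Sg (map N Sg) f HG Htop Hbot He) as (v & Hv & Av & Kv).
  assert (L : forall a, In a Sg -> In a (map N Sg ++ Sg)).
  { intros a Ha. apply in_or_app. now right. }
  assert (M : forall a, In a Sg -> In (N a) (map N Sg ++ Sg)).
  { intros a Ha. apply in_or_app. left. now apply in_map. }
  exists (fun a => v (N a)). split.
  - intros a b Ha Hb. rewrite <- (Av a), <- (Av b); trivial.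
    repeat split; apply Hv; auto.
  - intros e Hin K. apply Kv; trivial. now apply in_map.
Qed.

Lemma state_step f : state f -> exists g, step f g.
Proof.
  intros (_ & _ & Gam & HG & He).
  destruct (step_exists true 0 Gam f HG He) as (g & Hg & _). exists g. now exists Gam.
Qed.

Lemma step_A f g a : step f g -> In (A a) Sg -> f (A a) = Rmin (f a) (g (A a)).
Proof.
  intros (Gam & HG & H) Ha. assert (Ha' := HA a Ha). apply Rle_antisym.
  - apply Rmin_glb; apply H; trivial; [now apply cth_A_l|now apply cth_A_next].
  - destruct (cth_total _ HG a (N (A a))) as [K|K].
    + eapply Rle_trans; [apply Rmin_l|]. apply H; trivial.
      apply (fun L => cth_trans _ HG _ _ _ L (cth_A_fold _ HG a)).
      apply cth_imp_and; trivial. split; [now apply cth_refl|trivial].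
    + eapply Rle_trans; [apply Rmin_r|]. apply H; trivial.
      apply (fun L => cth_trans _ HG _ _ _ L (cth_A_fold _ HG a)).
      apply cth_imp_and; trivial. split; [trivial|now apply cth_refl].
Qed.

Lemma step_U f g a b : step f g -> In (U a b) Sg ->
  f (U a b) = Rmax (f b) (Rmin (f a) (g (U a b))).
Proof.
  intros (Gam & HG & H) Hu. destruct (HU a b Hu) as [Ha Hb].
  assert (F := cth_U_fold _ HG a b). apply (cth_or_imp _ HG) in F as [F1 F2].
  assert (V := cth_U_unfold _ HG a b).
  apply Rle_antisym.
  - destruct (cth_total _ HG b (And a (N (U a b)))) as [K|K].
    + eapply Rle_trans; [|apply Rmax_r].
      assert (J : Gam (Imp (U a b) (And a (N (U a b))))).
      { apply (cth_trans _ HG _ _ _ V), cth_or_imp; trivial.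
        split; [trivial|now apply cth_refl]. }
      apply (cth_imp_and _ HG) in J as [J1 J2]. apply Rmin_glb; apply H; trivial.
    + eapply Rle_trans; [|apply Rmax_l]. apply H; trivial.
      apply (cth_trans _ HG _ _ _ V), cth_or_imp; trivial.
      split; [now apply cth_refl|trivial].
  - apply Rmax_lub; [apply H; trivial|].
    destruct (cth_total _ HG a (N (U a b))) as [K|K].
    + eapply Rle_trans; [apply Rmin_l|]. apply H; trivial.
      apply (fun L => cth_trans _ HG _ _ _ L F2).
      apply cth_imp_and; trivial. split; [now apply cth_refl|trivial].
    + eapply Rle_trans; [apply Rmin_r|]. apply H; trivial.
      apply (fun L => cth_trans _ HG _ _ _ L F2).
      apply cth_imp_and; trivial. split; [trivial|now apply cth_refl].
Qed.

Lemma step_next f g a : step f g -> In a Sg -> In (N a) Sg -> f (N a) = g a.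
Proof.
  intros (Gam & HG & H) Ha Hn. apply Rle_antisym; apply H; trivial; now apply cth_refl.
Qed.

(** * Eventualities reached through the induction axioms *)

Definition comparisons : list form :=
  map (fun p => Imp (fst p) (snd p)) (list_prod Sg Sg).

(** Whether [f] realizes a theory on [Sg] depends only on the comparisons, and the description [x]
    settles these. *)
Lemma emb_transfer Gam Gam' f x : cth Gam -> cth Gam' -> In x (chars comparisons) ->
  Gam x -> Gam' x -> emb Gam Sg f -> emb Gam' Sg f.
Proof.
  intros HG HG' Hx K K' He a b Ha Hb. rewrite (He a b Ha Hb).
  apply (chars_agree Gam Gam' comparisons x); trivial.
  apply (in_map (fun p => Imp (fst p) (snd p)) _ (a, b)). now apply in_prod.
Qed.

(* If no such path exists, the disjunction [theta] of all [x /\ d], where the description [x] is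
   realized at the end of a path and [d] is least among the formulas of value at least [c] there,
   satisfies [theta => N theta] and [theta => a], hence [theta => A a]. *)
Lemma reach_A f a c : state f -> In (A a) Sg -> f (A a) < c ->
  exists g, reach step (fun _ => True) f g /\ g a < c.
Proof.
  intros Hf Ha Hc. assert (Ha' := HA a Ha). apply NNPP. intros NO.
  assert (Hno : forall g, reach step (fun _ => True) f g -> c <= g a).
  { intros g Hg. apply Rnot_lt_le. intros K. apply NO. now exists g. }
  (* The empty path already gives [c <= f a]. Hence [ftop] always has value at least [c], and a
     least formula with that property exists. *)
  assert (C1 : c <= 1).
  { apply Rle_trans with (f a); [apply Hno; constructor|now apply state_bound]. }
  assert (S1 : forall g, reach step (fun _ => True) f g -> state g).
  { induction 1; [trivial|eapply step_state; eassumption]. }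
  (* One witnessing theory is enough: any other theory containing [x] is realized by the same
     [g]. *)
  set (Q := fun x d => exists g Gam, reach step (fun _ => True) f g /\ cth Gam /\
    emb Gam Sg g /\ Gam x /\ c <= g d /\ forall e, In e Sg -> c <= g e -> g d <= g e).
  set (theta := bigor (map (fun p => And (fst p) (snd p))
    (select (fun p => Q (fst p) (snd p)) (list_prod (chars comparisons) Sg)))).
  assert (Intro : forall Gam x d, cth Gam -> In x (chars comparisons) -> In d Sg ->
    Q x d -> Gam x -> Gam (Imp d theta)).
  { intros Gam x d HG Hx Hd HQ Kx. apply cth_trans with (And x d); trivial.
    - apply cth_imp_and; trivial. split; [now apply cth_true|now apply cth_refl].
    - apply cth_imp_bigor; trivial.
      apply (in_map (fun p => And (fst p) (snd p)) _ (x, d)), select_in.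
      split; [now apply in_prod|trivial]. }
  assert (Elim : forall Gam e, cth Gam -> (forall x d, In x (chars comparisons) -> In d Sg ->
    Q x d -> Gam x -> Gam (Imp d e)) -> Gam (Imp theta e)).
  { intros Gam e HG H. apply cth_bigor_imp; trivial.
    intros y Hy. apply in_map_iff in Hy as ([x d] & <- & Hy).
    apply select_in in Hy as [Hy HQ]. apply in_prod_iff in Hy as [Hx Hd]. simpl in *.
    destruct (chars_dec Gam comparisons x HG Hx) as [K|K].
    - apply cth_trans with d; trivial; [now apply cth_and_r|now apply (H x)].
    - apply cth_trans with fbot; trivial; [|now apply cth_bot].
      apply (cth_trans _ HG _ x); trivial. now apply cth_and_l. }
  assert (Ta : GTL (Imp theta a)).
  { apply gtl_complete. intros Gam HG. apply Elim; trivial.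
    intros x d Hx Hd (g & Gam' & Hg & HG' & He & Kx' & Hcd & Hmin) Kx.
    apply (emb_transfer Gam' Gam g x HG' HG Hx Kx' Kx He); auto. }
  assert (Tn : GTL (Imp theta (N theta))).
  { apply gtl_complete. intros Gam HG. apply Elim; trivial.
    intros x d Hx Hd (g & Gam' & Hg & HG' & He' & Kx' & Hcd & Hmin) Kx.
    assert (He : emb Gam Sg g) by (eapply (emb_transfer Gam' Gam); eassumption).
    (* With new values kept below [c] where possible, the least formula [d'] of value at least [c]
       at [h] has [N d'] above some [e] of value at least [c] at [g]. Minimality of [d] gives the
       chain [d], [e], [N d'], [N theta]. *)
    destruct (step_exists true c Gam g HG He) as (h & Hh & Kh).
    assert (Hgh : step g h) by now exists Gam.
    assert (Rh : reach step (fun _ => True) f h) by (econstructor; eauto).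
    destruct (finite_min (fun e => c <= h e) h Sg) as (d' & Hd' & Kd' & Md').
    { exists ftop. split; trivial. destruct (S1 h Rh) as (-> & _). trivial. }
    assert (HN := cth_shift Gam HG).
    destruct (chars_exists _ comparisons HN) as (x' & Hx' & Kx'').
    assert (J : Gam (N (Imp d' theta))).
    { apply (Intro _ x' d' HN Hx' Hd'); trivial.
      exists h, (fun e => Gam (N e)).
      refine (conj Rh (conj HN (conj _ (conj Kx'' (conj Kd' _))))); [|auto].
      now apply step_by_emb with g. }
    apply (cth_N_imp _ HG) in J. apply (fun L => cth_trans _ HG _ _ _ L J).
    destruct (Kh d' Hd' Kd') as (e & Hein & Ke & Oe).
    apply (fun L => cth_trans _ HG _ _ _ L Oe). apply He; auto. }
  destruct (Hf) as (F1 & _ & Gam & HG & He).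
  destruct (finite_min (fun e => c <= f e) f Sg) as (d & Hd & Kd & Md).
  { exists ftop. split; trivial. now rewrite F1. }
  destruct (chars_exists _ comparisons HG) as (x & Hx & Kx).
  assert (J : Gam (Imp d (A a))).
  { apply (cth_trans _ HG _ theta).
    - apply (Intro _ x d HG Hx Hd); trivial.
      exists f, Gam. refine (conj _ (conj HG (conj He (conj Kx (conj Kd _))))); [|auto].
      constructor.
    - now apply (cth_gtl _ HG), gtl_A_ind. }
  apply He in J; trivial. lra.
Qed.

(* Dually, if no such path exists, the conjunction [theta] of all [x => d], where [d] is greatest
   among the formulas of value at most [c], satisfies [b => theta] and [a /\ N theta => theta],
   hence [a U b => theta]. *)
Lemma reach_U f a b c : state f -> In (U a b) Sg -> c < f (U a b) ->
  exists g, reach step (fun h => c < h a) f g /\ c < g b.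
Proof.
  intros Hf Hu Hc. destruct (HU a b Hu) as [Ha Hb]. apply NNPP. intros NO.
  set (path := reach step (fun h => c < h a)) in *.
  assert (Hno : forall g, path f g -> g b <= c).
  { intros g Hg. apply Rnot_lt_le. intros K. apply NO. now exists g. }
  assert (C0 : 0 <= c).
  { apply Rle_trans with (f b); [now apply state_bound|apply Hno; constructor]. }
  assert (S1 : forall g, path f g -> state g).
  { induction 1; [trivial|eapply step_state; eassumption]. }
  set (Q := fun x d => exists g Gam, path f g /\ cth Gam /\
    emb Gam Sg g /\ Gam x /\ g d <= c /\ forall e, In e Sg -> g e <= c -> g e <= g d).
  set (theta := bigand (map (fun p => Imp (fst p) (snd p))
    (select (fun p => Q (fst p) (snd p)) (list_prod (chars comparisons) Sg)))).
  assert (Elim : forall Gam x d, cth Gam -> In x (chars comparisons) -> In d Sg ->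
    Q x d -> Gam x -> Gam (Imp theta d)).
  { intros Gam x d HG Hx Hd HQ Kx. apply cth_trans with (Imp x d); trivial.
    - apply cth_bigand_imp; trivial.
      apply (in_map (fun p => Imp (fst p) (snd p)) _ (x, d)), select_in.
      split; [now apply in_prod|trivial].
    - apply (cth_der _ HG [x]).
      + apply der_ded. by_mp x. hyp.
      + intros z [<-|[]]; trivial. }
  assert (Intro : forall Gam e, cth Gam -> (forall x d, In x (chars comparisons) -> In d Sg ->
    Q x d -> Gam x -> Gam (Imp e d)) -> Gam (Imp e theta)).
  { intros Gam e HG H. apply cth_imp_bigand; trivial.
    intros y Hy. apply in_map_iff in Hy as ([x d] & <- & Hy).
    apply select_in in Hy as [Hy HQ]. apply in_prod_iff in Hy as [Hx Hd]. simpl in *.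
    destruct (chars_dec Gam comparisons x HG Hx) as [K|K].
    - apply cth_trans with d; trivial; [now apply (H x)|apply (cth_gtl _ HG), gtl_k].
    - apply cth_true; trivial. apply (cth_trans _ HG _ fbot); trivial. now apply cth_bot. }
  assert (Tb : GTL (Imp b theta)).
  { apply gtl_complete. intros Gam HG. apply Intro; trivial.
    intros x d Hx Hd (g & Gam' & Hg & HG' & He & Kx' & Hcd & Hmax) Kx.
    apply (emb_transfer Gam' Gam g x HG' HG Hx Kx' Kx He); auto. }
  assert (Tn : GTL (Imp (And a (N theta)) theta)).
  { apply gtl_complete. intros Gam HG. apply Intro; trivial.
    intros x d Hx Hd (g & Gam' & Hg & HG' & He' & Kx' & Hcd & Hmax) Kx.
    assert (He : emb Gam Sg g) by (eapply (emb_transfer Gam' Gam); eassumption).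
    (* Where [a] is at most [c] the path may not be prolonged, but then [a] lies below [d] by
       maximality. *)
    destruct (Rle_lt_dec (g a) c) as [La|La].
    { apply cth_trans with a; trivial; [now apply cth_and_l|]. apply He; auto. }
    apply cth_trans with (N theta); trivial; [now apply cth_and_r|].
    destruct (step_exists false c Gam g HG He) as (h & Hh & Kh).
    assert (Hgh : step g h) by now exists Gam.
    assert (Rh : path f h) by (econstructor; eauto).
    destruct (finite_max (fun e => h e <= c) h Sg) as (d' & Hd' & Kd' & Md').
    { exists fbot. split; trivial. destruct (S1 h Rh) as (_ & -> & _). trivial. }
    assert (HN := cth_shift Gam HG).
    destruct (chars_exists _ comparisons HN) as (x' & Hx' & Kx'').
    assert (J : Gam (N (Imp theta d'))).
    { apply (Elim _ x' d' HN Hx' Hd'); trivial.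
      exists h, (fun e => Gam (N e)).
      refine (conj Rh (conj HN (conj _ (conj Kx'' (conj Kd' _))))); [|auto].
      now apply step_by_emb with g. }
    apply (cth_N_imp _ HG) in J. apply (cth_trans _ HG _ _ _ J).
    destruct (Kh d' Hd' Kd') as (e & Hein & Ke & Oe).
    apply (cth_trans _ HG _ _ _ Oe). apply He; auto. }
  destruct (Hf) as (_ & F0 & Gam & HG & He).
  destruct (finite_max (fun e => f e <= c) f Sg) as (d & Hd & Kd & Md).
  { exists fbot. split; trivial. now rewrite F0. }
  destruct (chars_exists _ comparisons HG) as (x & Hx & Kx).
  assert (J : Gam (Imp (U a b) d)).
  { apply (cth_trans _ HG _ theta).
    - now apply (cth_gtl _ HG), gtl_U_ind.
    - apply (Elim _ x d HG Hx Hd); trivial.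
      exists f, Gam. repeat (split; trivial). constructor. }
  apply He in J; trivial. lra.
Qed.

(** * Paths fulfilling all eventualities *)

(** A finite path kept as a total function; entries past [h] are arbitrary and may be overwritten by
    an extension. *)
Definition window (h : nat) (p : nat -> form -> R) : Prop :=
  forall i, (i < h)%nat -> step (p i) (p (S i)).

Definition extends (h : nat) (p : nat -> form -> R) (h' : nat) (p' : nat -> form -> R) : Prop :=
  (h <= h')%nat /\ forall i, (i <= h)%nat -> p' i = p i.

Lemma extends_refl h p : extends h p h p.
Proof. split; [lia|trivial]. Qed.

Lemma extends_trans h p h1 p1 h2 p2 :
  extends h p h1 p1 -> extends h1 p1 h2 p2 -> extends h p h2 p2.
Proof.
  intros [L1 E1] [L2 E2]. split; [lia|]. intros i Hi. rewrite E2, E1; trivial. lia.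
Qed.

Lemma window_append Q h p g : window h p -> reach step Q (p h) g ->
  exists h' p', window h' p' /\ extends h p h' p' /\ p' h' = g /\
    forall i, (h <= i < h')%nat -> Q (p' i).
Proof.
  intros W. induction 1 as [|g g' Hr (h' & p' & W' & [L E] & Eg & HQ) Hg Hs].
  - exists h, p. repeat split; trivial; intros; lia.
  - exists (S h'), (fun i => if le_lt_dec i h' then p' i else g'). split; [|split; [split|split]].
    + intros i Hi. destruct (le_lt_dec i h') as [J|J]; [|lia].
      destruct (le_lt_dec (S i) h') as [J'|J']; [now apply W'|].
      replace i with h' by lia. now rewrite Eg.
    + lia.
    + intros i Hi. destruct (le_lt_dec i h'); [now apply E|lia].
    + destruct (le_lt_dec (S h') h'); [lia|trivial].
    + intros i Hi. destruct (le_lt_dec i h') as [J|J]; [|lia].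
      destruct (Nat.eq_dec i h') as [->|K]; [now rewrite Eg|apply HQ; lia].
Qed.

Lemma window_state h p i : window h p -> state (p 0%nat) -> (i <= h)%nat -> state (p i).
Proof.
  intros W H0. induction i as [|i IH]; intros Hi; trivial.
  apply step_state with (p i); [apply IH; lia|apply W; lia].
Qed.

(** The fixpoint equation hands an unmet eventuality from instant to instant up to the end of the
    window, where [reach_A] prolongs the path. *)
Lemma window_A a c m : forall n h p, h = (n + m)%nat -> window h p -> state (p 0%nat) ->
  In (A a) Sg -> p n (A a) < c ->
  exists h' p', window h' p' /\ extends h p h' p' /\
    exists j, (n <= j <= h')%nat /\ p' j a < c.
Proof.
  induction m as [|m IH]; intros n h p Eh W H0 Ha Hc.
  - replace n with h in * by lia.
    destruct (reach_A (p h) a c) as (g & Hg & Kg); trivial.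
    { now apply window_state with h. }
    destruct (window_append _ h p g W Hg) as (h' & p' & W' & E & <- & _).
    exists h', p'. repeat (split; trivial). exists h'. split; [destruct E; lia|trivial].
  - destruct (Rlt_le_dec (p n a) c) as [K|K].
    + exists h, p. split; [trivial|]. split; [apply extends_refl|].
      exists n. split; [lia|trivial].
    + destruct (IH (S n) h p) as (h' & p' & W' & E & j & Hj & Kj); trivial; [lia| |].
      * assert (S : step (p n) (p (S n))) by (apply W; lia).
        rewrite (step_A _ _ a S) in Hc; trivial.
        unfold Rmin in Hc. destruct Rle_dec in Hc; lra.
      * exists h', p'. repeat (split; trivial). exists j. split; [lia|trivial].
Qed.

Lemma window_U a b c m : forall n h p, h = (n + m)%nat -> window h p -> state (p 0%nat) ->
  In (U a b) Sg -> c < p n (U a b) ->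
  exists h' p', window h' p' /\ extends h p h' p' /\
    exists j, (n <= j <= h')%nat /\ c < p' j b /\ forall i, (n <= i < j)%nat -> c < p' i a.
Proof.
  induction m as [|m IH]; intros n h p Eh W H0 Ha Hc.
  - replace n with h in * by lia.
    destruct (reach_U (p h) a b c) as (g & Hg & Kg); trivial.
    { now apply window_state with h. }
    destruct (window_append _ h p g W Hg) as (h' & p' & W' & E & <- & HQ).
    exists h', p'. repeat (split; trivial). exists h'. split; [destruct E; lia|now split].
  - destruct (Rlt_le_dec c (p n b)) as [K|K].
    + exists h, p. split; [trivial|]. split; [apply extends_refl|].
      exists n. split; [lia|]. split; [trivial|intros; lia].
    + assert (S : step (p n) (p (S n))) by (apply W; lia).
      assert (J : c < p n a /\ c < p (Datatypes.S n) (U a b)).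
      { rewrite (step_U _ _ a b S) in Hc; trivial. unfold Rmax, Rmin in Hc.
        repeat destruct Rle_dec in Hc; lra. }
      destruct J as [J1 J2].
      destruct (IH (Datatypes.S n) h p) as (h' & p' & W' & E & j & Hj & Kj & Lj); trivial; [lia|].
      exists h', p'. repeat (split; trivial). exists j. split; [lia|]. split; [trivial|].
      intros i Hi. destruct (Nat.eq_dec i n) as [->|Hne]; [|apply Lj; lia].
      destruct E as [_ E]. rewrite E; [trivial|lia].
Qed.

(** Infima and suprema need not be attained, so a request is served only to within [eps]. One pair
    carries the requests for both operators. *)
Definition meets (h : nat) (p : nat -> form -> R) (eps : R) (r : nat * (form * form)) : Prop :=
  let (n, ab) := r in let (a, b) := ab in
  (In (A a) Sg -> exists j, (n <= j <= h)%nat /\ p j a < p n (A a) + eps) /\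
  (In (U a b) Sg -> exists j, (n <= j <= h)%nat /\ p n (U a b) - eps < p j b /\
     forall i, (n <= i < j)%nat -> p n (U a b) - eps < p i a).

Lemma meets_extends h p h' p' eps r : (fst r <= h)%nat -> extends h p h' p' ->
  meets h p eps r -> meets h' p' eps r.
Proof.
  destruct r as (n & a & b). simpl. intros Hn [L E] [HA' HU']. split.
  - intros H. destruct (HA' H) as (j & Hj & K). exists j. split; [lia|].
    rewrite !E; trivial; lia.
  - intros H. destruct (HU' H) as (j & Hj & K & K'). exists j. split; [lia|].
    rewrite !E by lia. split; [trivial|]. intros i Hi. rewrite E by lia. now apply K'.
Qed.

Lemma window_meets h p eps r : window h p -> state (p 0%nat) -> 0 < eps -> (fst r <= h)%nat ->
  exists h' p', window h' p' /\ extends h p h' p' /\ meets h' p' eps r.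
Proof.
  destruct r as (n & a & b). simpl. intros W H0 He Hn.
  assert (J : exists h1 p1, window h1 p1 /\ extends h p h1 p1 /\
    (In (A a) Sg -> exists j, (n <= j <= h1)%nat /\ p1 j a < p1 n (A a) + eps)).
  { destruct (classic (In (A a) Sg)) as [Ha|Ha].
    - destruct (window_A a (p n (A a) + eps) (h - n) n h p)
        as (h1 & p1 & W1 & E1 & j & Hj & Kj); trivial; [lia|lra|].
      exists h1, p1. repeat (split; trivial). intros _. exists j. split; [trivial|].
      destruct E1 as [_ E1]. now rewrite (E1 n).
    - exists h, p. split; [trivial|]. split; [apply extends_refl|tauto]. }
  destruct J as (h1 & p1 & W1 & E1 & J1).
  assert (H1 : state (p1 0%nat)) by (destruct E1 as [_ E1]; rewrite E1; [trivial|lia]).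
  destruct (classic (In (U a b) Sg)) as [Hu|Hu].
  - destruct (window_U a b (p1 n (U a b) - eps) (h1 - n) n h1 p1)
      as (h2 & p2 & W2 & E2 & j & Hj & Kj & Lj); trivial; [destruct E1; lia|lra|].
    exists h2, p2. split; [trivial|]. split; [eapply extends_trans; eassumption|].
    assert (L1 : (n <= h1)%nat) by (destruct E1; lia).
    destruct E2 as [L2 E2]. split.
    + intros Ha. destruct (J1 Ha) as (k & Hk & Kk). exists k. split; [lia|].
      rewrite !E2; trivial; lia.
    + intros _. exists j. split; [trivial|]. now rewrite (E2 n).
  - exists h1, p1. repeat (split; trivial). tauto.
Qed.

Lemma window_meets_list eps l : 0 < eps -> forall h p, window h p -> state (p 0%nat) ->
  (forall r, In r l -> (fst r <= h)%nat) ->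
  exists h' p', window h' p' /\ extends h p h' p' /\ forall r, In r l -> meets h' p' eps r.
Proof.
  intros He. induction l as [|r l IH]; intros h p W H0 Hl.
  - exists h, p. split; [trivial|]. split; [apply extends_refl|easy].
  - destruct (window_meets h p eps r) as (h1 & p1 & W1 & E1 & M1); trivial.
    { apply Hl. now left. }
    destruct (IH h1 p1) as (h2 & p2 & W2 & E2 & M2); trivial.
    { destruct E1 as [_ E1]. rewrite E1; [trivial|lia]. }
    { intros r' Hr'. destruct E1 as [L1 _]. specialize (Hl r' (or_intror Hr')). lia. }
    exists h2, p2. split; [trivial|]. split; [eapply extends_trans; eassumption|].
    intros r' [<-|Hr']; [|auto]. apply (meets_extends h1 p1); trivial.
    destruct E1 as [L1 _]. specialize (Hl r (or_introl eq_refl)). lia.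
Qed.

Definition stage (eps : R) (w w' : nat * (nat -> form -> R)) : Prop :=
  window (fst w') (snd w') /\ extends (fst w) (snd w) (fst w') (snd w') /\
  (fst w < fst w')%nat /\
  forall n a b, (n <= fst w)%nat -> In a Sg -> In b Sg ->
    meets (fst w') (snd w') eps (n, (a, b)).

Lemma stage_exists eps w : 0 < eps -> window (fst w) (snd w) -> state (snd w 0%nat) ->
  exists w', stage eps w w'.
Proof.
  destruct w as [h p]; simpl. intros He W H0.
  destruct (window_meets_list eps (list_prod (seq 0 (S h)) (list_prod Sg Sg)) He h p)
    as (h1 & p1 & W1 & E1 & M1); trivial.
  { intros [n ab] Hr. apply in_prod_iff in Hr as [Hn _]. apply in_seq in Hn. simpl. lia. }
  assert (H1 : state (p1 0%nat)) by (destruct E1 as [_ E1]; rewrite E1; [trivial|lia]).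
  destruct (state_step (p1 h1)) as (g & Hg). { now apply window_state with h1. }
  exists (S h1, fun i => if le_lt_dec i h1 then p1 i else g).
  assert (E2 : extends h1 p1 (S h1) (fun i => if le_lt_dec i h1 then p1 i else g)).
  { split; [lia|]. intros i Hi. destruct (le_lt_dec i h1); [trivial|lia]. }
  split; [|split; [|split]]; cbn [fst snd].
  - intros i Hi. destruct (le_lt_dec i h1) as [J|J]; [|lia].
    destruct (le_lt_dec (S i) h1) as [J'|J']; [now apply W1|].
    now replace i with h1 by lia.
  - eapply extends_trans; eassumption.
  - destruct E1; lia.
  - intros n a b Hn Ha Hb. apply (meets_extends h1 p1); [simpl; destruct E1; lia|trivial|].
    apply M1, in_prod; [apply in_seq; lia|now apply in_prod].
Qed.

Definition fulfils (p : nat -> form -> R) (n : nat) : Prop :=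
  (forall a c, In (A a) Sg -> p n (A a) < c -> exists j, (n <= j)%nat /\ p j a < c) /\
  (forall a b c, In (U a b) Sg -> c < p n (U a b) ->
     exists j, (n <= j)%nat /\ c < p j b /\ forall i, (n <= i < j)%nat -> c < p i a).

(** Stage [k] serves the requests of all instants of the current window to within 1/(k+1). Every
    instant is treated again at all later stages, so any given error is eventually undercut. *)
Lemma path_exists f : state f ->
  exists p, p 0%nat = f /\ (forall n, step (p n) (p (S n))) /\ forall n, fulfils p n.
Proof.
  intros Hf.
  (* [choice] needs a successor for every pair, so the conditions on the window become premises
     inside the relation. *)
  destruct (choice (fun (kw : nat * (nat * (nat -> form -> R))) w' =>
    window (fst (snd kw)) (snd (snd kw)) -> state (snd (snd kw) 0%nat) ->
    stage (/ INR (S (fst kw))) (snd kw) w')) as [nxt Hnxt].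
  { intros [k w]; simpl.
    destruct (classic (window (fst w) (snd w) /\ state (snd w 0%nat))) as [[K1 K2]|K].
    - destruct (stage_exists (/ INR (S k)) w) as (w' & Hw'); trivial.
      + apply Rinv_0_lt_compat, lt_0_INR. lia.
      + now exists w'.
    - exists w. tauto. }
  set (W := fix W k := match k with 0 => (0%nat, fun _ : nat => f)
                       | S k => nxt (k, W k) end).
  assert (HW : forall k, window (fst (W k)) (snd (W k)) /\ snd (W k) 0%nat = f).
  { induction k as [|k [IH1 IH2]].
    - split; [intros i Hi; simpl in Hi; lia|trivial].
    - assert (K : stage (/ INR (S k)) (W k) (W (S k))).
      { apply (Hnxt (k, W k)); simpl; [trivial|now rewrite IH2]. }
      destruct K as (K1 & [_ K2] & _). split; [trivial|].
      rewrite K2; [trivial|lia]. }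
  assert (St : forall k, stage (/ INR (S k)) (W k) (W (S k))).
  { intros k. destruct (HW k) as [K1 K2].
    apply (Hnxt (k, W k)); simpl; [trivial|now rewrite K2]. }
  assert (Le : forall k, (k <= fst (W k))%nat).
  { induction k as [|k IH]; [simpl; lia|]. destruct (St k) as (_ & _ & L & _). lia. }
  assert (Ex : forall k m, (k <= m)%nat ->
    extends (fst (W k)) (snd (W k)) (fst (W m)) (snd (W m))).
  { induction 1 as [|m Hm IH]; [apply extends_refl|].
    eapply extends_trans; [exact IH|]. apply (St m). }
  (* A diagonal limit: the window of stage [n] covers instant [n] by [Le], and later stages leave it
     unchanged by [Ex]. *)
  set (p := fun n => snd (W n) n).
  assert (Ag : forall k i, (i <= fst (W k))%nat -> p i = snd (W k) i).
  { intros k i Hi. unfold p. destruct (le_lt_dec i k) as [J|J].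
    - destruct (Ex i k J) as [_ E]. symmetry. apply E, Le.
    - destruct (Ex k i) as [_ E]; [lia|]. now apply E. }
  exists p. split; [apply (HW 0%nat)|]. split.
  { intros n. assert (L := Le (S n)). rewrite !(Ag (S n)) by lia. apply HW. lia. }
  assert (Eps : forall d n, 0 < d -> exists k, (n <= k)%nat /\ / INR (S k) < d).
  { intros d n Hd. destruct (archimed_cor1 d Hd) as (m & Hm & Hm').
    exists (n + m)%nat. split; [lia|]. eapply Rle_lt_trans; [|exact Hm].
    apply Rinv_le_contravar; [now apply lt_0_INR|apply le_INR; lia]. }
  intros n. split.
  - intros a c Ha Hc. destruct (Eps (c - p n (A a)) n) as (k & Hk & Kk); [lra|].
    destruct (St k) as (_ & [Lk _] & _ & M). assert (L := Le k).
    destruct (M n a a) as [MA _]; [lia|now apply HA|now apply HA|].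
    destruct (MA Ha) as (j & Hj & Kj). exists j. split; [lia|].
    rewrite <- !(Ag (S k)) in Kj by lia. lra.
  - intros a b c Hu Hc. destruct (Eps (p n (U a b) - c) n) as (k & Hk & Kk); [lra|].
    destruct (St k) as (_ & [Lk _] & _ & M). assert (L := Le k).
    destruct (M n a b) as [_ MU]; [lia|now apply (HU a b)|now apply (HU a b)|].
    destruct (MU Hu) as (j & Hj & Kj & Lj). exists j. split; [lia|].
    rewrite <- !(Ag (S k)) in Kj by lia. split; [lra|].
    intros i Hi. specialize (Lj i Hi). rewrite <- !(Ag (S k)) in Lj by lia. lra.
Qed.

Lemma fulfils_back p n : step (p n) (p (S n)) -> fulfils p (S n) -> fulfils p n.
Proof.
  intros St [FA FU]. split.
  - intros a c Ha Hc. destruct (Rlt_le_dec (p n a) c) as [K|K].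
    + exists n. split; [lia|trivial].
    + destruct (FA a c Ha) as (j & Hj & Kj); [|exists j; split; [lia|trivial]].
      rewrite (step_A _ _ a St) in Hc; trivial. unfold Rmin in Hc. destruct Rle_dec in Hc; lra.
  - intros a b c Hu Hc. destruct (Rlt_le_dec c (p n b)) as [K|K].
    + exists n. split; [lia|]. split; [trivial|intros; lia].
    + rewrite (step_U _ _ a b St) in Hc; trivial.
      assert (J : c < p n a /\ c < p (S n) (U a b)).
      { unfold Rmax, Rmin in Hc. repeat destruct Rle_dec in Hc; lra. }
      destruct J as [J1 J2].
      destruct (FU a b c Hu J2) as (j & Hj & Kj & Lj). exists j. split; [lia|]. split; [trivial|].
      intros i Hi. destruct (Nat.eq_dec i n) as [->|Hne]; [trivial|apply Lj; lia].
Qed.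

Lemma fulfils_shift p n m : fulfils p (m + n) -> fulfils (fun j => p (m + j)%nat) n.
Proof.
  intros [FA FU]. split.
  - intros a c Ha Hc. destruct (FA a c Ha Hc) as (j & Hj & Kj).
    exists (j - m)%nat. split; [lia|]. now replace (m + (j - m))%nat with j by lia.
  - intros a b c Hu Hc. destruct (FU a b c Hu Hc) as (j & Hj & Kj & Lj).
    exists (j - m)%nat. split; [lia|]. replace (m + (j - m))%nat with j by lia.
    split; [trivial|]. intros i Hi. apply Lj. lia.
Qed.

Lemma fulfils_Z (s : Z -> form -> R) : (forall k, step (s k) (s (Z.succ k))) ->
  (forall n, fulfils (fun j => s (Z.of_nat j)) n) ->
  forall k, fulfils (fun j => s (k + Z.of_nat j)%Z) 0.
Proof.
  intros Hs HF k.
  assert (B : forall m, fulfils (fun j => s (- Z.of_nat m + Z.of_nat j)%Z) 0).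
  { intros m.
    (* Index [m - d] stands for the integer [- d]: the induction starts at 0, where the given path
       fulfils its eventualities, and walks left by [fulfils_back]. *)
    assert (D : forall d, (d <= m)%nat ->
      fulfils (fun j => s (- Z.of_nat m + Z.of_nat j)%Z) (m - d)).
    { induction d as [|d IH]; intros Hd.
      - assert (F := HF 0%nat). split.
        + intros a c Ha Hc. destruct F as [FA _].
          destruct (FA a c Ha) as (j & Hj & Kj).
          { now replace (Z.of_nat 0) with (- Z.of_nat m + Z.of_nat (m - 0))%Z by lia. }
          exists (m + j)%nat. split; [lia|].
          now replace (- Z.of_nat m + Z.of_nat (m + j))%Z with (Z.of_nat j) by lia.
        + intros a b c Hu Hc. destruct F as [_ FU].
          destruct (FU a b c Hu) as (j & Hj & Kj & Lj).
          { now replace (Z.of_nat 0) with (- Z.of_nat m + Z.of_nat (m - 0))%Z by lia. }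
          exists (m + j)%nat. split; [lia|].
          replace (- Z.of_nat m + Z.of_nat (m + j))%Z with (Z.of_nat j) by lia.
          split; [trivial|]. intros i Hi.
          replace (- Z.of_nat m + Z.of_nat i)%Z with (Z.of_nat (i - m)) by lia.
          apply Lj. lia.
      - apply fulfils_back.
        + replace (- Z.of_nat m + Z.of_nat (S (m - S d)))%Z
            with (Z.succ (- Z.of_nat m + Z.of_nat (m - S d))) by lia. apply Hs.
        + replace (S (m - S d)) with (m - d)%nat by lia. apply IH. lia. }
    replace 0%nat with (m - m)%nat by lia. now apply D. }
  destruct (Z_le_gt_dec 0 k) as [J|J].
  - assert (F := fulfils_shift (fun j => s (Z.of_nat j)) 0 (Z.to_nat k) (HF _)).
    enough (E : (fun j => s (Z.of_nat (Z.to_nat k + j))) = (fun j => s (k + Z.of_nat j)%Z))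
      by now rewrite <- E.
    apply functional_extensionality. intros j. f_equal. lia.
  - specialize (B (Z.to_nat (- k))).
    now replace (- Z.of_nat (Z.to_nat (- k)))%Z with k in B by lia.
Qed.

End Steps.

(** Shifting the witnessing theory by [N] makes the later instant the current one, and the
    equivalence of [N (P a)] with [a] recovers the earlier one. This allows forward and backward
    paths to be glued. *)
Lemma step_converse N P A U Sg f g : tense N P A U -> step N Sg f g -> step P Sg g f.
Proof.
  intros HT (Gam & HG & H). exists (fun a => Gam (N a)).
  split; [now apply (cth_shift N P A U HT)|].
  assert (E1 : forall a, Gam (Imp a (N (P a)))).
  { intros a. apply (cth_gtl _ HG), gtl_iff_l, (tense_np _ _ _ _ HT). }
  assert (E2 : forall a, Gam (Imp (N (P a)) a)).
  { intros a. apply (cth_gtl _ HG), gtl_iff_r, (tense_np _ _ _ _ HT). }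
  intros a b Ha Hb. rewrite !(cth_N_imp N P A U HT Gam HG).
  destruct (H a b Ha Hb) as (H1 & H2 & H3 & H4). rewrite H1, H2, H3, H4.
  repeat split; intros K; trivial.
  - now apply cth_trans with b.
  - now apply cth_trans with (N (P b)).
  - now apply cth_trans with a.
  - now apply cth_trans with (N (P a)).
  - apply cth_trans with a; trivial. now apply cth_trans with b.
  - apply cth_trans with (N (P a)); trivial. now apply cth_trans with (N (P b)).
Qed.

(** * Soundness for bi-relational frames *)

Lemma itr_succ_r {T} (s : T -> T) n t : itr s (S n) t = itr s n (s t).
Proof. apply Nat.iter_succ_r. Qed.

Section Soundness.
Variables (W T : Type) (le : W -> W -> Prop) (S Si : T -> T) (val : nat -> W -> T -> Prop).
Hypothesis le_refl : forall w, le w w.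
Hypothesis le_trans : forall x y z, le x y -> le y z -> le x z.
Hypothesis le_total : forall x y, le x y \/ le y x.
Hypothesis S_Si : forall t, S (Si t) = t.
Hypothesis Si_S : forall t, Si (S t) = t.
Hypothesis val_down : forall n v w t, le v w -> val n w t -> val n v t.

Notation den := (rden W T le S Si val).
Definition holds (a : form) : Prop := forall w t, den a w t.

Lemma rden_down a : forall v w t, le v w -> den a w t -> den a v t.
Proof.
  induction a as [n|a IHa b IHb|a IHa b IHb|a IHa b IHb|a IHa b IHb|a IHa|a IHa|a IHa|a IHa
    |a IHa b IHb|a IHa b IHb]; simpl; intros v w t L.
  - now apply val_down.
  - intros [Ha Hb]; split; eauto.
  - intros [Ha|Hb]; [left|right]; eauto.
  - intros H x Lx. apply H. eauto.
  - intros (x & Lx & H). exists x. split; eauto.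
  - eauto.
  - eauto.
  - eauto.
  - eauto.
  - intros (n & H1 & H2). exists n. split; eauto.
  - intros (n & H1 & H2). exists n. split; eauto.
Qed.

Lemma rden_bot w t : ~ den fbot w t.
Proof. simpl. intros (v & _ & H1 & H2). tauto. Qed.

(** The Kripke order is the reverse of the frame order, since truth persists downward in a frame. *)
Lemma rden_psubst s A t : forall w,
  den (psubst s A) w t <-> kforce W (fun x y => le y x) (fun n w => den (s n) w t) A w.
Proof.
  induction A as [n| |A IHA B IHB|A IHA B IHB|A IHA B IHB]; intros w.
  - reflexivity.
  - split; [apply rden_bot|now simpl].
  - simpl. now rewrite IHA, IHB.
  - simpl. now rewrite IHA, IHB.
  - simpl. split; intros H v L K; apply IHB, H, IHA; trivial.
Qed.

Lemma tense_axiom_holds N A U (s : T -> T) :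
  (forall a w t, den (N a) w t <-> den a w (s t)) ->
  (forall a w t, den (A a) w t <-> forall n, den a w (itr s n t)) ->
  (forall a b w t, den (U a b) w t <-> exists n, den b w (itr s n t) /\
     forall i, (i < n)%nat -> den a w (itr s i t)) ->
  forall a, tense_axiom N A U a -> holds a.
Proof.
  intros HN HA HU.
  assert (HC : forall a b w t, den (And a b) w t <-> den a w t /\ den b w t) by reflexivity.
  assert (HO : forall a b w t, den (Or a b) w t <-> den a w t \/ den b w t) by reflexivity.
  intros a Ha w t. destruct Ha as [|a b|a b|a b|a b|a b c|a b c|a|a b|a|a b].
  - intros v _ K. apply HN, rden_bot in K. easy.
  - intros v _ K. apply HN, HO in K. apply HO.
    destruct K; [left|right]; now apply HN.
  - intros v _ K. apply HC in K as [K1 K2]. apply HN, HC. split; now apply HN.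
  - apply HC. split; intros v _ K.
    + apply HN in K. intros x Lx Kx. apply HN. apply HN in Kx. now apply K.
    + apply HN. intros x Lx Kx. apply HN. apply K; trivial. now apply HN.
  - intros v _ K x Lx Kx. apply HA. intros n. apply (proj1 (HA _ _ _) K n x Lx), HA, Kx.
  - intros v _ K x Lx Kx. apply HU in Kx as (n & K1 & K2). apply HU. exists n.
    split; [|trivial]. apply (proj1 (HA _ _ _) K n x Lx), K1.
  - intros v _ K x Lx Kx. apply HU in Kx as (n & K1 & K2). apply HU. exists n.
    split; [trivial|]. intros i Hi. apply (proj1 (HA _ _ _) K i x Lx), K2, Hi.
  - intros v _ K. apply HC. split; [apply (proj1 (HA _ _ _) K 0%nat)|].
    apply HN, HA. intros n. rewrite <- itr_succ_r. apply (proj1 (HA _ _ _) K).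
  - intros v _ K. apply HO in K as [K|K]; apply HU.
    + exists 0%nat. split; [trivial|intros; lia].
    + apply HC in K as [K1 K2]. apply HN, HU in K2 as (n & K2 & K3).
      exists (Datatypes.S n). rewrite itr_succ_r. split; [trivial|].
      intros [|i] Hi; [trivial|]. rewrite itr_succ_r. apply K3. lia.
  - intros v _ K x Lx Kx. apply HA. intros n. induction n as [|n IH]; [trivial|].
    apply HN. now apply (proj1 (HA _ _ _) K n x Lx).
  - intros v _ K x Lx Kx. apply HU in Kx as (n & K1 & K2).
    (* Descent from the instant [n] at which [a] holds, [d] counting the steps back towards [t]. *)
    assert (D : forall d, (d <= n)%nat -> den a x (itr s (n - d) t)).
    { induction d as [|d IH]; intros Hd; [now rewrite Nat.sub_0_r|].
      apply (proj1 (HA _ _ _) K (n - Datatypes.S d)%nat x Lx), HC.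
      split; [apply K2; lia|]. apply HN.
      change (den a x (itr s (Datatypes.S (n - Datatypes.S d)) t)).
      replace (Datatypes.S (n - Datatypes.S d)) with (n - d)%nat by lia. apply IH. lia. }
    specialize (D n). rewrite Nat.sub_diag in D. now apply D.
Qed.

Lemma GTL_holds a : GTL a -> holds a.
Proof.
  induction 1 as [A s HA|a b|a b|a b|a Ha|a Ha|a|a|a b c _ IH|a b c _ IH|a b _ IH1 _ IH2
    |a _ IH|a _ IH|a _ IH|a _ IH]; intros w t.
  - apply rden_psubst, HA; eauto. intros n x y L. now apply rden_down.
  - intros v _ K. simpl. destruct (classic (den b v t)); [now left|right]. now exists v.
  - simpl. apply NNPP. intros K. apply not_or_and in K as [K1 K2].
    apply not_all_ex_not in K1 as (x & K1). apply not_all_ex_not in K2 as (y & K2).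
    apply imply_to_and in K1 as [Lx K1]. apply imply_to_and in K1 as [Kx Nx].
    apply imply_to_and in K2 as [Ly K2]. apply imply_to_and in K2 as [Ky Ny].
    destruct (le_total x y); [apply Nx|apply Ny]; eapply rden_down; eauto.
  - intros v _ K. simpl in K. destruct K as ((x & Lx & Kx & Nx) & y & Ly & Ky & Ny).
    exfalso. destruct (le_total x y); [apply Nx|apply Ny]; eapply rden_down; eauto.
  - revert a Ha w t. apply (tense_axiom_holds Defs.Nx Gf Until S); reflexivity.
  - revert a Ha w t. apply (tense_axiom_holds Pv Hp Since Si); reflexivity.
  - simpl. rewrite Si_S. tauto.
  - simpl. rewrite S_Si. tauto.
  - intros v _ (x & Lx & Kx & Nx). exists x. repeat split; trivial. now apply (IH x t x).
  - intros v _ (x & Lx & Kx & Nx).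
    (* The world [x] witnessing the coimplication falsifies [b], so [c] holds there and persists
       down to [v]. *)
    destruct (IH x t x (le_refl x) Kx) as [K|K]; [easy|]. now apply rden_down with x.
  - now apply (IH1 w t w), IH2.
  - apply IH.
  - apply IH.
  - intros n. apply IH.
  - intros n. apply IH.
Qed.

End Soundness.

Lemma GTL_Grel a : GTL a -> Grel a.
Proof. intros Ha W T le S Si val Hr Ht _ Hl H1 H2 Hd. now apply GTL_holds. Qed.

(** * From real-valued to bi-relational models *)

(** Cantor's nested intervals: the [n]-th cut leaves a closed interval without [u n]. Starting from
    the middle third keeps the limit strictly between [x] and [y]. *)
Lemma avoid_sequence (u : nat -> R) x y : x < y -> exists z, x < z < y /\ forall n, z <> u n.
Proof.
  intros Hxy.
  set (cut := fun r (I : R * R) => let m := (fst I + snd I) / 2 in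
    if Rlt_dec r m then (m, snd I) else (fst I, (fst I + m) / 2)).
  set (I := fix I n := match n with
    | 0 => ((2 * x + y) / 3, (x + 2 * y) / 3)
    | S n => cut (u n) (I n) end).
  assert (Hlt : forall n, fst (I n) < snd (I n)).
  { induction n as [|n IH]; simpl; [lra|]. unfold cut.
    destruct Rlt_dec; simpl in *; lra. }
  assert (Hstep : forall n, fst (I n) <= fst (I (S n)) /\ snd (I (S n)) <= snd (I n)).
  { intros n. specialize (Hlt n). simpl. unfold cut. destruct Rlt_dec; simpl; lra. }
  assert (Hmon : forall n m, (n <= m)%nat ->
    fst (I n) <= fst (I m) /\ snd (I m) <= snd (I n)).
  { induction 1 as [|m Hm IH]; [lra|]. specialize (Hstep m). lra. }
  assert (Hup : forall n m, fst (I n) <= snd (I m)).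
  { intros n m. assert (K := Hlt (max n m)).
    assert (K1 := Hmon n (max n m) (Nat.le_max_l _ _)).
    assert (K2 := Hmon m (max n m) (Nat.le_max_r _ _)). lra. }
  destruct (completeness (fun r => exists n, r = fst (I n))) as (z & Hz1 & Hz2).
  { exists (snd (I 0%nat)). intros r (n & ->). apply Hup. }
  { now exists (fst (I 0%nat)), 0%nat. }
  assert (Hz : forall n, fst (I n) <= z <= snd (I n)).
  { intros n. split; [apply Hz1; now exists n|]. apply Hz2. intros r (m & ->). apply Hup. }
  exists z. split.
  - specialize (Hz 0%nat). simpl in Hz. lra.
  - intros n ->. specialize (Hz (S n)). specialize (Hlt n). revert Hz. simpl. unfold cut.
    destruct Rlt_dec; simpl; lra.
Qed.

Lemma chain_gt {T} (s : T -> T) f g c n : forall t,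
  c < chain s f g n t <-> c < g (itr s n t) /\ forall i, (i < n)%nat -> c < f (itr s i t).
Proof.
  induction n as [|n IH]; intros t.
  - simpl. split; [intros K; split; [trivial|intros; lia]|tauto].
  - rewrite itr_succ_r. simpl. split.
    + intros K. assert (K1 : c < f t) by (eapply Rlt_le_trans; [exact K|apply Rmin_l]).
      assert (K2 : c < chain s f g n (s t)) by (eapply Rlt_le_trans; [exact K|apply Rmin_r]).
      apply IH in K2 as [K2 K3]. split; trivial.
      intros [|i] Hi; [trivial|]. rewrite itr_succ_r. apply K3. lia.
    + intros [K1 K2]. apply Rmin_glb_lt; [apply (K2 0%nat); lia|]. apply IH. split; trivial.
      intros i Hi. rewrite <- itr_succ_r. apply K2. lia.
Qed.

Fixpoint subforms (a : form) : list form :=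
  a :: match a with
       | Var _ => []
       | And a b | Or a b | Imp a b | Coimp a b | Until a b | Since a b =>
           subforms a ++ subforms b
       | Nx a | Pv a | Gf a | Hp a => subforms a
       end.

Lemma subforms_refl a : In a (subforms a).
Proof. destruct a; now left. Qed.

Lemma subforms_trans a b c : In a (subforms b) -> In b (subforms c) -> In a (subforms c).
Proof.
  intros Hab. induction c; intros Hb; destruct Hb as [<-|Hb]; trivial; right; try easy; auto;
    apply in_app_or in Hb as [Hb|Hb]; apply in_or_app; auto.
Qed.

Ltac sub_arg := simpl; right; rewrite ?in_app_iff; auto using subforms_refl.

Section Bounds.
Variables (T : Type) (S Si : T -> T) (V : form -> T -> R).
Hypothesis HV : real_valuation T S Si V.

Lemma glb_bound (s : T -> T) a t m : (forall t, 0 <= V a t <= 1) ->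
  is_glb (fun x => exists n, x = V a (itr s n t)) m -> 0 <= m <= 1.
Proof.
  intros Ha [H1 H2]. split.
  - apply H2. intros x (n & ->). apply Ha.
  - eapply Rle_trans; [apply H1; now exists 0%nat|apply Ha].
Qed.

Lemma chain_bound (s : T -> T) a b n : (forall t, 0 <= V a t <= 1) ->
  (forall t, 0 <= V b t <= 1) -> forall t, 0 <= chain s (V a) (V b) n t <= 1.
Proof.
  intros Ha Hb. induction n as [|n IH]; intros t; simpl; [apply Hb|].
  specialize (Ha t). specialize (IH (s t)). unfold Rmin. destruct Rle_dec; lra.
Qed.

Lemma lub_bound (s : T -> T) a b t m : (forall t, 0 <= V a t <= 1) ->
  (forall t, 0 <= V b t <= 1) ->
  is_lub (fun x => exists n, x = chain s (V a) (V b) n t) m -> 0 <= m <= 1.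
Proof.
  intros Ha Hb [H1 H2]. assert (K := chain_bound s a b). split.
  - eapply Rle_trans; [|apply H1; now exists 0%nat]. now apply K.
  - apply H2. intros x (n & ->). now apply K.
Qed.

Lemma real_valuation_bound a : forall t, 0 <= V a t <= 1.
Proof.
  destruct HV as (h1 & h2 & h3 & h4 & h5 & h6 & h7 & h8 & h9 & h10 & h11).
  induction a as [n|a IHa b IHb|a IHa b IHb|a IHa b IHb|a IHa b IHb|a IHa|a IHa|a IHa|a IHa
    |a IHa b IHb|a IHa b IHb]; intros t.
  - apply h1.
  - rewrite h2. specialize (IHa t). specialize (IHb t). unfold Rmin. destruct Rle_dec; lra.
  - rewrite h3. specialize (IHa t). specialize (IHb t). unfold Rmax. destruct Rle_dec; lra.
  - rewrite h4. specialize (IHb t). destruct Rle_dec; lra.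
  - rewrite h5. specialize (IHa t). destruct Rle_dec; lra.
  - rewrite h6. apply IHa.
  - rewrite h7. apply IHa.
  - eapply glb_bound; [exact IHa|apply h8].
  - eapply glb_bound; [exact IHa|apply h9].
  - eapply lub_bound; [exact IHa|exact IHb|apply h10].
  - eapply lub_bound; [exact IHa|exact IHb|apply h11].
Qed.

End Bounds.

(** * Unattained thresholds as worlds *)

Section Thresholds.
Variables (T : Type) (S Si : T -> T) (V : form -> T -> R) (phi : form) (t0 : T).
Hypothesis S_Si : forall t, S (Si t) = t.
Hypothesis Si_S : forall t, Si (S t) = t.
Hypothesis HV : real_valuation T S Si V.

Definition orbit (t : T) : Prop := exists n, t = itr S n t0 \/ t = itr Si n t0.

Lemma orbit_S t : orbit t -> orbit (S t).
Proof.
  intros (n & [->| ->]); [now exists (Datatypes.S n); left|].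
  destruct n as [|n]; [now exists 1%nat; left|]. exists n. right. apply S_Si.
Qed.

Lemma orbit_Si t : orbit t -> orbit (Si t).
Proof.
  intros (n & [->| ->]); [|now exists (Datatypes.S n); right].
  destruct n as [|n]; [now exists 1%nat; right|]. exists n. left. apply Si_S.
Qed.

Lemma orbit_itr s n t : (forall t, orbit t -> orbit (s t)) -> orbit t -> orbit (itr s n t).
Proof. intros Hs Ht. induction n as [|n IH]; [trivial|]. now apply Hs. Qed.

(** Only countably many values are to be avoided: two Cantor pairings code the position of a
    subformula, a direction of time and a number of steps. *)
Definition attained (m : nat) : R :=
  let (i, j) := Cantor.of_nat m in let (d, n) := Cantor.of_nat j in
  V (nth i (subforms phi) phi) (match d with 0 => itr S n t0 | _ => itr Si n t0 end).

Lemma attained_spec a t : In a (subforms phi) -> orbit t -> exists m, attained m = V a t.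
Proof.
  intros Ha (n & Ht). apply (In_nth _ _ phi) in Ha as (i & _ & <-).
  destruct Ht as [->| ->].
  - exists (Cantor.to_nat (i, Cantor.to_nat (0%nat, n))).
    unfold attained. now rewrite !Cantor.cancel_of_to.
  - exists (Cantor.to_nat (i, Cantor.to_nat (1%nat, n))).
    unfold attained. now rewrite !Cantor.cancel_of_to.
Qed.

(* Thresholds are not attained as values, so that strict and weak comparison with a value agree
   and both infima and suprema are respected. *)
Definition threshold (w : R) : Prop := 0 < w < 1 /\ forall m, w <> attained m.

Lemma threshold_between x y : 0 <= x -> x < y -> y <= 1 ->
  exists w : {w | threshold w}, x < proj1_sig w < y.
Proof.
  intros H0 Hxy H1. destruct (avoid_sequence attained x y Hxy) as (z & Hz & Hn).
  assert (K : threshold z) by (split; [lra|trivial]). now exists (exist _ z K).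
Qed.

Lemma threshold_neq (w : {w | threshold w}) a t : In a (subforms phi) -> orbit t ->
  proj1_sig w <> V a t.
Proof.
  intros Ha Ht. destruct (attained_spec a t Ha Ht) as (m & <-). apply (proj2_sig w).
Qed.

Lemma glb_threshold (w : {w | threshold w}) (s : T -> T) a t m :
  proj1_sig w <> m -> is_glb (fun x => exists n, x = V a (itr s n t)) m ->
  ((forall n, proj1_sig w < V a (itr s n t)) <-> proj1_sig w < m).
Proof.
  intros Hw [H1 H2]. split.
  - intros H. enough (proj1_sig w <= m) by lra. apply H2. intros x (n & ->). now apply Rlt_le.
  - intros H n. eapply Rlt_le_trans; [exact H|]. apply H1. now exists n.
Qed.

Lemma lub_threshold w (s : T -> T) a b t m :
  is_lub (fun x => exists n, x = chain s (V a) (V b) n t) m ->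
  ((exists n, w < V b (itr s n t) /\ forall i, (i < n)%nat -> w < V a (itr s i t)) <-> w < m).
Proof.
  intros [H1 H2]. split.
  - intros (n & Hn). apply chain_gt in Hn. eapply Rlt_le_trans; [exact Hn|].
    apply H1. now exists n.
  - intros H. apply NNPP. intros K. enough (m <= w) by lra. apply H2. intros x (n & ->).
    apply Rnot_lt_le. intros J. apply chain_gt in J. apply K. now exists n.
Qed.

Lemma threshold_truth a : In a (subforms phi) -> forall (w : {w | threshold w}) t, orbit t ->
  (rden {w | threshold w} T (fun x y => proj1_sig x <= proj1_sig y) S Si
     (fun n w t => proj1_sig w < V (Var n) t) a w t <-> proj1_sig w < V a t).
Proof.
  assert (Hb := real_valuation_bound T S Si V HV).
  assert (Sub : forall b c, In b (subforms c) -> In c (subforms phi) -> In b (subforms phi)).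
  { intros b c. apply subforms_trans. }
  destruct HV as (h1 & h2 & h3 & h4 & h5 & h6 & h7 & h8 & h9 & h10 & h11).
  induction a as [n|a IHa b IHb|a IHa b IHb|a IHa b IHb|a IHa b IHb|a IHa|a IHa|a IHa|a IHa
    |a IHa b IHb|a IHa b IHb]; intros Hs w t Ht;
    try (assert (Ha : In a (subforms phi)) by (eapply Sub; [|exact Hs]; sub_arg);
      specialize (IHa Ha));
    try (assert (Hb' : In b (subforms phi)) by (eapply Sub; [|exact Hs]; sub_arg);
      specialize (IHb Hb')); simpl.
  - tauto.
  - rewrite IHa, IHb, h2; trivial. unfold Rmin. destruct Rle_dec; lra.
  - rewrite IHa, IHb, h3; trivial. unfold Rmax. destruct Rle_dec; lra.
  - rewrite h4. split.
    + intros H. destruct Rle_dec as [K|K]; [apply (proj2_sig w)|].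
      apply Rnot_le_lt. intros J.
      assert (J' : V b t < proj1_sig w) by (assert (N := threshold_neq w b t Hb' Ht); lra).
      (* A threshold in this interval is a world below [w] that satisfies [a] but not [b]. *)
      destruct (threshold_between (V b t) (Rmin (V a t) (proj1_sig w))) as (v & Hv1 & Hv2).
      * apply Hb.
      * apply Rmin_glb_lt; lra.
      * eapply Rle_trans; [apply Rmin_l|apply Hb].
      * assert (M1 := Rmin_l (V a t) (proj1_sig w)). assert (M2 := Rmin_r (V a t) (proj1_sig w)).
        assert (L : proj1_sig v < V b t); [|lra].
        apply IHb; trivial. apply H; [lra|]. apply IHa; trivial. lra.
    + intros H v L Ka. apply IHa in Ka; trivial. apply IHb; trivial.
      destruct Rle_dec; lra.
  - rewrite h5. split.
    + intros (v & L & Ka & Kb). apply IHa in Ka; trivial. rewrite IHb in Kb; trivial.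
      destruct Rle_dec; lra.
    + intros H. destruct Rle_dec as [K|K]; [destruct w as (w & [] & ?); simpl in *; lra|].
      (* Here the threshold is a world above [w] satisfying [a] but not [b]. *)
      destruct (threshold_between (Rmax (V b t) (proj1_sig w)) (V a t)) as (v & Hv1 & Hv2).
      * eapply Rle_trans; [|apply Rmax_l]. apply Hb.
      * apply Rmax_lub_lt; lra.
      * apply Hb.
      * assert (M1 := Rmax_l (V b t) (proj1_sig w)). assert (M2 := Rmax_r (V b t) (proj1_sig w)).
        exists v. rewrite IHa, IHb; trivial. lra.
  - rewrite h6. apply IHa; trivial. now apply orbit_S.
  - rewrite h7. apply IHa; trivial. now apply orbit_Si.
  - rewrite <- (glb_threshold w S a t (V (Gf a) t)); [|now apply threshold_neq|apply h8].
    split; intros H n; apply IHa; trivial; apply orbit_itr; trivial; apply orbit_S.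
  - rewrite <- (glb_threshold w Si a t (V (Hp a) t)); [|now apply threshold_neq|apply h9].
    split; intros H n; apply IHa; trivial; apply orbit_itr; trivial; apply orbit_Si.
  - rewrite <- (lub_threshold (proj1_sig w) S a b t (V (Until a b) t)); [|apply h10].
    assert (O : forall n, orbit (itr S n t)) by (intros; apply orbit_itr; trivial; apply orbit_S).
    split; intros (n & H1 & H2); exists n; (split; [now apply IHb|]);
      intros i Hi; apply IHa; auto.
  - rewrite <- (lub_threshold (proj1_sig w) Si a b t (V (Since a b) t)); [|apply h11].
    assert (O : forall n, orbit (itr Si n t)) by (intros; apply orbit_itr; trivial; apply orbit_Si).
    split; intros (n & H1 & H2); exists n; (split; [now apply IHb|]);
      intros i Hi; apply IHa; auto.
Qed.

Lemma Grel_value : Grel phi -> V phi t0 = 1.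
Proof.
  intros H. assert (Hb := real_valuation_bound T S Si V HV phi t0).
  apply NNPP. intros K.
  destruct (threshold_between (V phi t0) 1) as (w & Hw); [lra|lra|lra|].
  assert (O : orbit t0) by (exists 0%nat; now left).
  assert (L := proj1 (threshold_truth phi (subforms_refl phi) w t0 O)).
  enough (proj1_sig w < V phi t0) by lra. apply L, H; trivial.
  - intros; apply Rle_refl.
  - intros x y z; apply Rle_trans.
  - intros [x Hx] [y Hy]; simpl. intros L1 L2.
    apply subset_eq_compat. now apply Rle_antisym.
  - intros x y. destruct (Rle_lt_dec (proj1_sig x) (proj1_sig y)); [now left|right; lra].
  - intros n v x t Lv. lra.
Qed.

End Thresholds.

Lemma Grel_GR phi : Grel phi -> GR phi.
Proof. intros H T S Si V H1 H2 HV t. now apply (Grel_value T S Si V phi t). Qed.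

(** * Completeness *)

Definition sup (E : R -> Prop) : R := epsilon (inhabits 0) (is_lub E).
Definition inf (E : R -> Prop) : R := epsilon (inhabits 0) (is_glb E).

Lemma sup_spec (E : R -> Prop) : (exists x, E x) -> (forall x, E x -> x <= 1) -> is_lub E (sup E).
Proof.
  intros H1 H2. unfold sup. apply epsilon_spec. destruct (completeness E) as (m & Hm); trivial.
  - now exists 1.
  - now exists m.
Qed.

Lemma inf_spec (E : R -> Prop) : (exists x, E x) -> (forall x, E x -> 0 <= x) -> is_glb E (inf E).
Proof.
  intros (x & Hx) H. unfold inf. apply epsilon_spec.
  destruct (completeness (fun y => E (- y))) as (m & Hm1 & Hm2).
  - exists 0. intros y Hy. specialize (H _ Hy). lra.
  - exists (- x). now rewrite Ropp_involutive.
  - exists (- m). split.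
    + intros y Hy. enough (- y <= m) by lra. apply Hm1. now rewrite Ropp_involutive.
    + intros b Hb. enough (m <= - b) by lra. apply Hm2. intros y Hy. specialize (Hb _ Hy). lra.
Qed.

Lemma glb_unique E m m' : is_glb E m -> is_glb E m' -> m = m'.
Proof. intros [H1 H2] [H3 H4]. apply Rle_antisym; auto. Qed.

(** * Valuations generated by their atoms *)

Section Evaluation.
Variables (T : Type) (S Si : T -> T) (v : nat -> T -> R).
Hypothesis Hv : forall n t, 0 <= v n t <= 1.

(** [real_valuation] constrains every formula, whereas the paths are meaningful on [Sg] only; the
    model is therefore evaluated afresh from its atoms and compared with the path on [Sg]. *)
Fixpoint eval (a : form) (t : T) : R :=
  match a with
  | Var n => v n t
  | And a b => Rmin (eval a t) (eval b t)
  | Or a b => Rmax (eval a t) (eval b t)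
  | Imp a b => if Rle_dec (eval a t) (eval b t) then 1 else eval b t
  | Coimp a b => if Rle_dec (eval a t) (eval b t) then 0 else eval a t
  | Nx a => eval a (S t)
  | Pv a => eval a (Si t)
  | Gf a => inf (fun x => exists n, x = eval a (itr S n t))
  | Hp a => inf (fun x => exists n, x = eval a (itr Si n t))
  | Until a b => sup (fun x => exists n, x = chain S (eval a) (eval b) n t)
  | Since a b => sup (fun x => exists n, x = chain Si (eval a) (eval b) n t)
  end.

Lemma eval_inf s a t : (forall t, 0 <= eval a t <= 1) ->
  is_glb (fun x => exists n, x = eval a (itr s n t))
    (inf (fun x => exists n, x = eval a (itr s n t))).
Proof.
  intros Ha. apply inf_spec; [now exists (eval a t), 0%nat|]. intros x (n & ->). apply Ha.
Qed.

Lemma eval_sup s a b t : (forall t, 0 <= eval a t <= 1) -> (forall t, 0 <= eval b t <= 1) ->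
  is_lub (fun x => exists n, x = chain s (eval a) (eval b) n t)
    (sup (fun x => exists n, x = chain s (eval a) (eval b) n t)).
Proof.
  intros Ha Hb. apply sup_spec; [now exists (eval b t), 0%nat|]. intros x (n & ->).
  now apply chain_bound.
Qed.

Lemma eval_bound a : forall t, 0 <= eval a t <= 1.
Proof.
  induction a as [n|a IHa b IHb|a IHa b IHb|a IHa b IHb|a IHa b IHb|a IHa|a IHa|a IHa|a IHa
    |a IHa b IHb|a IHa b IHb]; intros t; simpl.
  - apply Hv.
  - specialize (IHa t). specialize (IHb t). unfold Rmin. destruct Rle_dec; lra.
  - specialize (IHa t). specialize (IHb t). unfold Rmax. destruct Rle_dec; lra.
  - specialize (IHb t). destruct Rle_dec; lra.
  - specialize (IHa t). destruct Rle_dec; lra.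
  - apply IHa.
  - apply IHa.
  - eapply glb_bound; [exact IHa|now apply eval_inf].
  - eapply glb_bound; [exact IHa|now apply eval_inf].
  - eapply lub_bound; [exact IHa|exact IHb|now apply eval_sup].
  - eapply lub_bound; [exact IHa|exact IHb|now apply eval_sup].
Qed.

Lemma eval_valuation : real_valuation T S Si eval.
Proof.
  assert (B := eval_bound). split; [intros; apply B|].
  do 6 (split; [reflexivity|]).
  split; [intros; now apply eval_inf|]. split; [intros; now apply eval_inf|].
  split; intros; now apply eval_sup.
Qed.

End Evaluation.

(** * Temporal clauses along a fulfilling path *)

Section PathLimits.
Variables (N P A : form -> form) (U : form -> form -> form) (Sg : list form).
Hypothesis HT : tense N P A U.
Hypothesis HA : forall a, In (A a) Sg -> In a Sg.
Hypothesis HU : forall a b, In (U a b) Sg -> In a Sg /\ In b Sg.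
Variables (T : Type) (s : T -> T) (x : T -> form -> R).
Hypothesis Hx : forall t, step N Sg (x t) (x (s t)).
Hypothesis HF : forall t, fulfils A U Sg (fun n => x (itr s n t)) 0.

Lemma path_inf a t : In (A a) Sg ->
  is_glb (fun y => exists n, y = x (itr s n t) a) (x t (A a)).
Proof.
  intros Ha. split.
  - intros y (n & ->).
    assert (K : forall t, x t (A a) <= x t a /\ x t (A a) <= x (s t) (A a)).
    { intros t'. rewrite (step_A N P A U HT Sg HA _ _ a (Hx t') Ha).
      split; [apply Rmin_l|apply Rmin_r]. }
    apply Rle_trans with (x (itr s n t) (A a)); [|apply K].
    induction n as [|n IH]; [apply Rle_refl|]. eapply Rle_trans; [exact IH|apply K].
  - intros b Hb. apply Rnot_lt_le. intros K. destruct (HF t) as [FA _].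
    destruct (FA a b Ha K) as (j & _ & Kj).
    enough (b <= x (itr s j t) a) by lra. apply Hb. now exists j.
Qed.

Lemma path_sup a b t : In (U a b) Sg ->
  is_lub (fun y => exists n, y = chain s (fun t => x t a) (fun t => x t b) n t) (x t (U a b)).
Proof.
  intros Hu.
  assert (E : forall t, x t (U a b) = Rmax (x t b) (Rmin (x t a) (x (s t) (U a b)))).
  { intros t'. now apply (step_U N P A U HT Sg HU). }
  split.
  - intros y (n & ->). revert t. induction n as [|n IH]; intros t; simpl; rewrite E.
    + apply Rmax_l.
    + eapply Rle_trans; [|apply Rmax_r]. apply Rle_min_compat_l, IH.
  - intros m Hm. apply Rnot_lt_le. intros K. destruct (HF t) as [_ FU].
    destruct (FU a b m Hu K) as (j & _ & Kj & Lj).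
    assert (J : m < chain s (fun t => x t a) (fun t => x t b) j t).
    { apply chain_gt. split; [trivial|]. intros i Hi. apply Lj. lia. }
    specialize (Hm _ (ex_intro _ j eq_refl)). lra.
Qed.

End PathLimits.

(** * Propositional clauses at a single state *)

Section Local.
Variables (Sg : list form) (f : form -> R).
Hypothesis Htop : In ftop Sg.
Hypothesis Hbot : In fbot Sg.
Hypothesis Hf : state Sg f.

Lemma state_and a b : In a Sg -> In b Sg -> In (And a b) Sg -> f (And a b) = Rmin (f a) (f b).
Proof.
  intros Ha Hb Hab. destruct Hf as (_ & _ & Gam & HG & He). apply Rle_antisym.
  - apply Rmin_glb; apply He; trivial; [now apply cth_and_l|now apply cth_and_r].
  - unfold Rmin. destruct Rle_dec as [K|K]; apply He; trivial; apply cth_imp_and; trivial.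
    + split; [now apply cth_refl|now apply He].
    + split; [|now apply cth_refl]. apply He; trivial. lra.
Qed.

Lemma state_or a b : In a Sg -> In b Sg -> In (Or a b) Sg -> f (Or a b) = Rmax (f a) (f b).
Proof.
  intros Ha Hb Hab. destruct Hf as (_ & _ & Gam & HG & He). apply Rle_antisym.
  - unfold Rmax. destruct Rle_dec as [K|K]; apply He; trivial; apply cth_or_imp; trivial.
    + split; [now apply He|now apply cth_refl].
    + split; [now apply cth_refl|]. apply He; trivial. lra.
  - apply Rmax_lub; apply He; trivial; [now apply cth_or_l|now apply cth_or_r].
Qed.

Lemma state_imp a b : In a Sg -> In b Sg -> In (Imp a b) Sg ->
  f (Imp a b) = if Rle_dec (f a) (f b) then 1 else f b.
Proof.
  intros Ha Hb Hab. assert (B := state_bound Sg Htop Hbot f _ Hf Hab).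
  destruct Hf as (E1 & _ & Gam & HG & He).
  destruct Rle_dec as [K|K].
  - apply Rle_antisym; [apply B|]. rewrite <- E1. apply He; trivial.
    apply cth_true; trivial. now apply He.
  - rewrite (He a b) in K by trivial. apply Rle_antisym; apply He; trivial.
    + now apply cth_imp_le.
    + apply (cth_gtl _ HG), gtl_k.
Qed.

Lemma state_coimp a b : In a Sg -> In b Sg -> In (Coimp a b) Sg ->
  f (Coimp a b) = if Rle_dec (f a) (f b) then 0 else f a.
Proof.
  intros Ha Hb Hab. assert (B := state_bound Sg Htop Hbot f _ Hf Hab).
  destruct Hf as (_ & E0 & Gam & HG & He).
  destruct Rle_dec as [K|K].
  - apply Rle_antisym; [|apply B]. rewrite <- E0. apply He; trivial.
    apply cth_coimp_bot; trivial. now apply He.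
  - rewrite (He a b) in K by trivial. apply Rle_antisym; apply He; trivial.
    + now apply cth_coimp_le.
    + now apply cth_coimp_ge.
Qed.

End Local.

(** * The model over the integers *)

Lemma initial_state Gam Sg : cth Gam -> exists f, emb Gam Sg f /\ f ftop = 1 /\ f fbot = 0.
Proof.
  intros HG. set (f := fun x => if excluded_middle_informative (x = ftop) then 1 else 0).
  assert (E1 : f ftop = 1) by (unfold f; now destruct excluded_middle_informative).
  assert (E0 : f fbot = 0) by (unfold f; now destruct excluded_middle_informative).
  assert (T : Gam ftop) by apply (cth_gtl _ HG), gtl_top.
  (* Consistency of [Gam] makes 1 and 0 a correct start for top and bottom; the formulas of [Sg] are
     then inserted without moving these two values. *)
  destruct (emb_insert_list true 0 Gam [ftop; fbot] Sg f HG) as (v & Hv & Av & _).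
  - now left.
  - now right; left.
  - intros x y [<-|[<-|[]]] [<-|[<-|[]]]; rewrite ?E1, ?E0; split; intros K; try lra.
    + now apply cth_refl.
    + destruct (cth_con _ HG). now apply (cth_mp _ HG ftop).
    + now apply cth_bot.
    + now apply cth_refl.
  - exists v. rewrite !Av by (simpl; tauto). repeat split; trivial; apply Hv;
      apply in_or_app; now left.
Qed.

Lemma itr_Zsucc n k : itr Z.succ n k = (k + Z.of_nat n)%Z.
Proof.
  induction n as [|n IH]; [simpl; lia|].
  change (Z.succ (itr Z.succ n k) = (k + Z.of_nat (S n))%Z). lia.
Qed.

Lemma itr_Zpred n k : itr Z.pred n k = (k - Z.of_nat n)%Z.
Proof.
  induction n as [|n IH]; [simpl; lia|].
  change (Z.pred (itr Z.pred n k) = (k - Z.of_nat (S n))%Z). lia.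
Qed.

Lemma GR_GTL phi : GR phi -> GTL phi.
Proof.
  intros HR. apply NNPP. intros Hn.
  assert (HG : exists Gam, cth Gam /\ ~ Gam phi).
  { apply NNPP. intros K. apply Hn, gtl_complete. intros Gam HG.
    apply NNPP. intros K'. apply K. now exists Gam. }
  destruct HG as (Gam & HG & Hphi).
  (* [Var 0] is included because [ftop] and [fbot] are built from it, so that [Sg] is closed under
     subformulas. *)
  set (Sg := [Var 0; ftop; fbot] ++ subforms phi).
  assert (Htop : In ftop Sg) by (simpl; tauto).
  assert (Hbot : In fbot Sg) by (simpl; tauto).
  assert (Hin : In phi Sg) by (apply in_or_app; right; apply subforms_refl).
  assert (Sub : forall a b, In b (subforms a) -> In a Sg -> In b Sg).
  { intros a b Hb Ha. apply in_app_or in Ha as [Ha|Ha].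
    - destruct Ha as [<-|[<-|[<-|[]]]]; simpl in Hb; apply in_or_app; left; simpl;
        unfold ftop, fbot; tauto.
    - apply in_or_app. right. now apply subforms_trans with a. }
  assert (HA1 : forall a, In (Gf a) Sg -> In a Sg) by (intros a; apply Sub; sub_arg).
  assert (HA2 : forall a, In (Hp a) Sg -> In a Sg) by (intros a; apply Sub; sub_arg).
  assert (HU1 : forall a b, In (Until a b) Sg -> In a Sg /\ In b Sg).
  { intros a b H; split; revert H; apply Sub; sub_arg. }
  assert (HU2 : forall a b, In (Since a b) Sg -> In a Sg /\ In b Sg).
  { intros a b H; split; revert H; apply Sub; sub_arg. }
  destruct (initial_state Gam Sg HG) as (f & He & E1 & E0).
  assert (Hf : state Sg f) by (split; [trivial|split; [trivial|now exists Gam]]).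
  destruct (path_exists Nx Pv Gf Until tense_future Sg Htop Hbot HA1 HU1 f Hf)
    as (p & p0 & ps & pf).
  destruct (path_exists Pv Nx Hp Since tense_past Sg Htop Hbot HA2 HU2 f Hf)
    as (q & q0 & qs & qf).
  (* Both paths start at [f], so they agree at 0; [step_converse] orients the steps of [q]
     forward. *)
  set (s := fun k => if Z_le_gt_dec 0 k then p (Z.to_nat k) else q (Z.to_nat (- k))).
  assert (sp : forall n, s (Z.of_nat n) = p n).
  { intros n. unfold s. destruct Z_le_gt_dec; [now rewrite Nat2Z.id|lia]. }
  assert (sq : forall n, s (- Z.of_nat n)%Z = q n).
  { intros n. unfold s. destruct Z_le_gt_dec as [K|K].
    - replace n with 0%nat by lia. simpl. congruence.
    - now rewrite Z.opp_involutive, Nat2Z.id. }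
  assert (Step : forall k, step Nx Sg (s k) (s (Z.succ k))).
  { intros k. destruct (Z_le_gt_dec 0 k) as [K|K].
    - replace (Z.succ k) with (Z.of_nat (S (Z.to_nat k))) by lia. rewrite sp.
      replace k with (Z.of_nat (Z.to_nat k)) at 1 by lia. rewrite sp. apply ps.
    - replace k with (- Z.of_nat (S (Z.to_nat (- Z.succ k))))%Z at 1 by lia. rewrite sq.
      replace (Z.succ k) with (- Z.of_nat (Z.to_nat (- Z.succ k)))%Z at 2 by lia. rewrite sq.
      apply (step_converse _ _ _ _ _ _ _ tense_past), qs. }
  assert (Step' : forall k, step Pv Sg (s k) (s (Z.pred k))).
  { intros k. apply (step_converse _ _ _ _ _ _ _ tense_future).
    rewrite <- (Z.succ_pred k) at 2. apply Step. }
  assert (F1 : forall k, fulfils Gf Until Sg (fun n => s (itr Z.succ n k)) 0).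
  { intros k. replace (fun n => s (itr Z.succ n k)) with (fun n => s (k + Z.of_nat n)%Z).
    - apply (fulfils_Z Nx Pv Gf Until tense_future Sg HA1 HU1); trivial.
      replace (fun j => s (Z.of_nat j)) with p; [trivial|].
      apply functional_extensionality. intros n. now rewrite sp.
    - apply functional_extensionality. intros n. now rewrite itr_Zsucc. }
  assert (F2 : forall k, fulfils Hp Since Sg (fun n => s (itr Z.pred n k)) 0).
  (* Reflecting the integers turns the past operators into future ones of the sequence [s (- j)]. *)
  { intros k. replace (fun n => s (itr Z.pred n k))
      with (fun n => (fun j => s (- j)%Z) (- k + Z.of_nat n)%Z).
    - apply (fulfils_Z Pv Nx Hp Since tense_past Sg HA2 HU2 (fun j => s (- j)%Z)).
      + intros j. replace (- Z.succ j)%Z with (Z.pred (- j)) by lia. apply Step'.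
      + replace (fun j => s (- Z.of_nat j)%Z) with q; [trivial|].
        apply functional_extensionality. intros n. now rewrite sq.
    - apply functional_extensionality. intros n. rewrite itr_Zpred. f_equal. lia. }
  assert (St : forall k, state Sg (s k)).
  { assert (K1 : forall n, state Sg (s (Z.of_nat n))).
    { induction n as [|n IH]; [now rewrite sp, p0|].
      apply (step_state _ _ _ _ tense_future Sg Htop Hbot _ _ IH).
      rewrite Nat2Z.inj_succ. apply Step. }
    assert (K2 : forall n, state Sg (s (- Z.of_nat n)%Z)).
    { induction n as [|n IH]; [now rewrite sq, q0|].
      apply (step_state _ _ _ _ tense_past Sg Htop Hbot _ _ IH).
      replace (- Z.of_nat (S n))%Z with (Z.pred (- Z.of_nat n)) by lia. apply Step'. }
    intros k. destruct (Z_le_gt_dec 0 k) as [K|K].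
    - specialize (K1 (Z.to_nat k)). now rewrite Z2Nat.id in K1.
    - specialize (K2 (Z.to_nat (- k))).
      now replace (- Z.of_nat (Z.to_nat (- k)))%Z with k in K2 by lia. }
  (* Variables outside [Sg] may have any real value on the path, so atoms are clamped to the unit
     interval; on [Sg] this changes nothing by [state_bound]. *)
  set (v := fun n k => Rmax 0 (Rmin 1 (s k (Var n)))).
  assert (Hv : forall n k, 0 <= v n k <= 1).
  { intros n k. unfold v. split; [apply Rmax_l|].
    apply Rmax_lub; [lra|apply Rmin_l]. }
  assert (Truth : forall a, In a Sg -> forall k, eval Z Z.succ Z.pred v a k = s k a).
  { assert (Lim : forall s' a k m, (forall k, eval Z Z.succ Z.pred v a k = s k a) ->
      is_glb (fun y => exists n, y = s (itr s' n k) a) m ->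
      inf (fun y => exists n, y = eval Z Z.succ Z.pred v a (itr s' n k)) = m).
    { intros s' a k m Ha Hm. eapply glb_unique; [|exact Hm].
      replace (fun y => exists n, y = s (itr s' n k) a)
        with (fun y => exists n, y = eval Z Z.succ Z.pred v a (itr s' n k)).
      - apply eval_inf. now apply eval_bound.
      - apply functional_extensionality. intros y. f_equal.
        apply functional_extensionality. intros n. now rewrite Ha. }
    assert (Lim' : forall s' a b k m, (forall k, eval Z Z.succ Z.pred v a k = s k a) ->
      (forall k, eval Z Z.succ Z.pred v b k = s k b) ->
      is_lub (fun y => exists n, y = chain s' (fun k => s k a) (fun k => s k b) n k) m ->
      sup (fun y => exists n, y = chain s' (eval Z Z.succ Z.pred v a)
        (eval Z Z.succ Z.pred v b) n k) = m).
    { intros s' a b k m Ha Hb Hm. eapply is_lub_u; [|exact Hm].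
      replace (fun k => s k a) with (eval Z Z.succ Z.pred v a)
        by now apply functional_extensionality.
      replace (fun k => s k b) with (eval Z Z.succ Z.pred v b)
        by now apply functional_extensionality.
      apply eval_sup; now apply eval_bound. }
    induction a as [n|a IHa b IHb|a IHa b IHb|a IHa b IHb|a IHa b IHb|a IHa|a IHa|a IHa|a IHa
      |a IHa b IHb|a IHa b IHb]; intros Hs k;
      try (assert (Ha : In a Sg) by (eapply Sub; [|exact Hs]; sub_arg); specialize (IHa Ha));
      try (assert (Hb : In b Sg) by (eapply Sub; [|exact Hs]; sub_arg); specialize (IHb Hb));
      simpl.
    - unfold v. destruct (state_bound Sg Htop Hbot _ _ (St k) Hs).
      now rewrite Rmin_right, Rmax_right.
    - now rewrite IHa, IHb, (state_and Sg _ (St k)).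
    - now rewrite IHa, IHb, (state_or Sg _ (St k)).
    - now rewrite IHa, IHb, (state_imp Sg _ Htop Hbot (St k)).
    - now rewrite IHa, IHb, (state_coimp Sg _ Htop Hbot (St k)).
    - rewrite IHa. symmetry. now apply (step_next Nx Sg).
    - rewrite IHa. symmetry. now apply (step_next Pv Sg).
    - apply Lim; trivial. now apply (path_inf Nx Pv Gf Until Sg tense_future).
    - apply Lim; trivial. now apply (path_inf Pv Nx Hp Since Sg tense_past).
    - apply Lim'; trivial. now apply (path_sup Nx Pv Gf Until Sg tense_future).
    - apply Lim'; trivial. now apply (path_sup Pv Nx Hp Since Sg tense_past). }
  assert (K : eval Z Z.succ Z.pred v phi 0%Z = 1).
  { apply (HR Z Z.succ Z.pred); [apply Z.succ_pred|apply Z.pred_succ|now apply eval_valuation]. }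
  rewrite Truth in K by trivial. rewrite (sp 0%nat : s 0%Z = p 0%nat), p0, <- E1 in K.
  (* Value 1 at instant 0 puts [phi] above [ftop] in the order of [Gam], so [phi] would belong to
     [Gam]. *)
  apply Hphi, (cth_mp _ HG ftop); [apply He; trivial; lra|]. apply (cth_gtl _ HG), gtl_top.
Qed.

Theorem theorem10p4 :
  forall phi : form, (GTL phi <-> Grel phi) /\ (Grel phi <-> GR phi).
Proof.
  intros phi. assert (H1 := GTL_Grel phi). assert (H2 := Grel_GR phi).
  assert (H3 := GR_GTL phi). tauto.
Qed.
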